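(* Let $G$ be a sorted and transitively closed DAG with vertex set $V=\{1,\dots,n\}$, let $A=\prod_{k=1}^n A_k\subseteq\mathbb R^n$ be a non-empty closed set with $A_k\subseteq\mathbb R$, and let $Q:\mathcal X\times A\to[0,\infty)$. Suppose that $A$ is compact and convex, that the map $\alpha\mapsto Q(x,\alpha)$ is convex for all $x\in\mathcal X$, and that for some $L>0$, $|Q(x,\alpha)-Q(y,\alpha)|\le L\,d_{\mathcal X}(x,y)$ for all $x,y\in\mathcal X$ and all $\alpha\in A$. Then $$|v(\mu)-v(\nu)|\le L\cdot W_{G,1}(\mu,\nu)\qquad\text{for all }\mu,\nu\in\mathcal P_1^G(\mathcal X),$$ where $$v(\mu)=\inf_{\alpha}\ \mathbb E_\mu[Q(X,\alpha)],$$ $X=\mathrm{Id}_{\mathcal X}$ has law $\mu$ under $\mathbb E_\mu$, and the infimum is over all $G$-adapted $A$-valued actions $\alpha=(\alpha_1,\dots,\alpha_n)$, i.e. such that for each $k$, $\alpha_k$ is $A_k$-valued and $\sigma(X_k,X_{\mathrm{pa}_k})$-measurable (equivalently $\alpha_k=H_k(X_k,X_{\mathrm{pa}_k})$ for a measurable $H_k:\mathcal X_k\times\mathcal X_{\mathrm{pa}_k}\to\mathbb R$).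
   Context: Directed graphs $G=(V,E)$ have a finite vertex set $V$ and edge set $E\subseteq\{(i,j)\in V\times V: i\neq j\}$; $\mathrm{pa}_i=\{j:(j,i)\in E\}$ is the set of parents of $i$, $\mathrm{an}_i$ is the set of ancestors of $i$ (vertices from which there is a directed path of length at least one to $i$), and $\mathrm{dsc}_i=\{j: i\in\mathrm{an}_j\}$. $G$ is a DAG if $i\notin\mathrm{an}_i$ for all $i$. A DAG on $\{1,\dots,n\}$ is sorted if $i<j$ whenever $i\in\mathrm{pa}_j$. $G$ is transitively closed if $i\in\mathrm{pa}_j$ and $j\in\mathrm{pa}_k$ imply $i\in\mathrm{pa}_k$. To each $v\in V$ are associated Polish spaces $\mathcal X_v,\mathcal Y_v$; $\mathcal X=\prod_{v\in V}\mathcal X_v$ and, for $B\subseteq V$, $\mathcal X_B=\prod_{v\in B}\mathcal X_v$, and $X_B$ denotes the projection of a random variable $X$ in $\mathcal X$ onto $\mathcal X_B$ (similarly for $\mathcal Y$). $\mathcal P(\Omega)$ is the set of Borel probability measures on a Polish space $\Omega$, and $d_\Omega$ denotes its metric (on $\mathcal X$, a metric inducing the product topology). $\mathcal P_1(\Omega)$ is the set of $\mu\in\mathcal P(\Omega)$ with $\int d_\Omega(x,x_0)\,d\mu(x)<\infty$ for some $x_0$. $\Pi(\mu,\nu)$ is the set of couplings of $\mu$ and $\nu$. For a DAG $G$, $\mu\in\mathcal P(\mathcal X)$ is $G$-compatible if, for $X\sim\mu$ and every $i\in V$, $X_i$ is conditionally independent of $X_{V\setminus(\mathrm{dsc}_i\cup\{i\})}$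 given $X_{\mathrm{pa}_i}$. $\mathcal P^G(\mathcal X)$ is the set of $G$-compatible measures and $\mathcal P_1^G(\mathcal X)=\mathcal P^G(\mathcal X)\cap\mathcal P_1(\mathcal X)$. For $\mu\in\mathcal P^G(\mathcal X)$, $\nu\in\mathcal P^G(\mathcal Y)$: let $G^c$ be the DAG with vertex set $\{i,i':i\in V\}$ ($i'$ a copy of $i$) and edge set $\{(i,j),(i,j'),(i',j'):(i,j)\in E\}\cup\{(i,i'):i\in V\}$, with $\mathcal X_i$ associated to $i$ and $\mathcal Y_i$ to $i'$. The set of $G$-causal couplings is $\Pi_G^c(\mu,\nu)=\Pi(\mu,\nu)\cap\mathcal P^{G^c}(\mathcal X\times\mathcal Y)$. A coupling $\pi\in\Pi(\mu,\nu)$ is $G$-anticausal if its pushforward under $(x,y)\mapsto(y,x)$ lies in $\Pi_G^c(\nu,\mu)$. The set of $G$-bicausal couplings $\Pi_G^{bc}(\mu,\nu)$ consists of the couplings that are both $G$-causal and $G$-anticausal. For $\mu,\nu\in\mathcal P_1^G(\mathcal X)$, $W_{G,1}(\mu,\nu)=\inf_{\pi\in\Pi_G^{bc}(\mu,\nu)}\int d_{\mathcal X}(x,y)\,d\pi(x,y)$. *)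

(* Defs.v *)
From HB Require Import structures.
From mathcomp Require Import all_boot all_order all_algebra.
From mathcomp Require Import all_classical all_reals all_analysis.

Set Implicit Arguments.
Unset Strict Implicit.
Unset Printing Implicit Defensive.

Import Order.TTheory GRing.Theory Num.Theory.
Import numFieldNormedType.Exports.

Local Open Scope classical_set_scope.
Local Open Scope ring_scope.

Section digraphs.
Variables (V : finType) (e : rel V).

(* The pair (i, j) is an edge iff [e i j]; [is_dag] implies irreflexivity. *)

Definition pa (i : V) : {set V} := [set j | e j i]%SET.

(* Ancestors are the sources of directed paths of length at least one, whereas
   [connect] also allows the empty path. *)
Definition an (i : V) : {set V} :=
  [set j | [exists k, e j k && connect e k i]]%SET.

Definition dsc (i : V) : {set V} := [set j | i \in an j]%SET.

Definition is_dag : Prop := forall i, i \notin an i.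

Definition transitively_closed : Prop :=
  forall i j k, i \in pa j -> j \in pa k -> i \in pa k.

(* [inl i] is the vertex i and [inr i] its copy i'. *)
Definition causal_graph : rel (V + V) := fun a b =>
  match a, b with
  | inl i, inl j => e i j
  | inl i, inr j => e i j || (i == j)
  | inr i, inr j => e i j
  | inr _, inl _ => false
  end.

End digraphs.

Definition sorted_graph (n : nat) (e : rel 'I_n) : Prop :=
  forall i j, i \in pa e j -> (i < j)%N.

Section metrics.
Variables (R : realType) (T : topologicalType).

Definition is_metric (d : T -> T -> R) : Prop :=
  [/\ forall x y, d x y = 0 <-> x = y,
      forall x y, d x y = d y x &
      forall x y z, d x z <= d x y + d y z].

Definition induces_topology (d : T -> T -> R) : Prop :=
  forall (x : T) (U : set T),
    nbhs x U <-> exists2 r : R, 0 < r & [set y | d x y < r] `<=` U.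

Definition complete_metric (d : T -> T -> R) : Prop :=
  forall u : nat -> T,
    (forall r : R, 0 < r ->
       exists N, forall k l, (N <= k)%N -> (N <= l)%N -> d (u k) (u l) < r) ->
    exists x : T, u @ \oo --> x.

Definition polish : Prop :=
  (exists2 D : set T, countable D & dense D) /\
  (exists d : T -> T -> R,
     [/\ is_metric d, induces_topology d & complete_metric d]).

End metrics.

Notation borel T := (g_sigma_algebraType (@open T)).

Section conditional_independence.
Context d (Omega : measurableType d) (R : realType) (P : probability Omega R).

(* [f] is a version of the conditional probability P(A | C), where C is a
   sub-sigma-algebra. *)
Definition is_cond_prob (C : set (set Omega)) (A : set Omega) (f : Omega -> R) :
    Prop :=
  [/\ forall B : set R, measurable B -> C (f @^-1` B),
      P.-integrable setT (EFin \o f) &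
      forall D, C D -> (\int[P]_(w in D) (f w)%:E = P (A `&` D))%E].

(* Versions always exist (Radon-Nikodym) and are almost surely unique, so the
   choice of the versions below is immaterial. *)
Definition cond_indep (F G C : set (set Omega)) : Prop :=
  forall A B, F A -> G B ->
  exists f g h : Omega -> R,
    [/\ is_cond_prob C A f, is_cond_prob C B g, is_cond_prob C (A `&` B) h &
        {ae P, forall w, h w = f w * g w}].

End conditional_independence.

HB.instance Definition _ (S T : ptopologicalType) := Pointed.on (S * T)%type.

HB.instance Definition _ (I : Type) (T : I -> ptopologicalType) :=
  isPointed.Build (prod_topology T) (fun=> point).

Section random_vectors.
Variables (V : finType) (X : V -> ptopologicalType).

Definition subproduct (B : {set V}) : ptopologicalType :=
  prod_topology (fun v : {v : V | v \in B} => X (sval v)).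

Context d (Omega : measurableType d).
Variable xi : forall v, Omega -> X v.

Definition subvector (B : {set V}) (w : Omega) : subproduct B :=
  fun v => xi (sval v) w.

Definition sigma1 (v : V) : set (set Omega) :=
  g_sigma_algebra_preimage (xi v : Omega -> borel (X v)).

Definition sigma_sub (B : {set V}) : set (set Omega) :=
  g_sigma_algebra_preimage (@subvector B : Omega -> borel (subproduct B)).

Definition graph_compatible (R : realType) (P : probability Omega R)
    (e : rel V) : Prop :=
  forall i, cond_indep P (sigma1 i) (sigma_sub (~: (i |: dsc e i))%SET)
                         (sigma_sub (pa e i)).

End random_vectors.

Lemma continuous_borel_measurable (S T : ptopologicalType)
    (f : borel S -> borel T) :
  continuous (f : S -> T) -> measurable_fun setT f.
Proof.
move=> /continuousP cf; apply: measurability.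
- exact: (erefl <<s @open T >>).
- by move=> _ [B oB <-]; rewrite setTI; apply: sub_sigma_algebra; exact: cf.
Qed.

Definition swap (S T : ptopologicalType) (z : borel (S * T)%type) :
    borel (T * S)%type := (z.2, z.1).

Lemma measurable_swap (S T : ptopologicalType) :
  measurable_fun setT (@swap S T).
Proof.
have cswap : continuous (fun z : S * T => (z.2, z.1) : T * S).
  by move=> z; apply: cvg_pair; [exact: cvg_snd|exact: cvg_fst].
exact: (continuous_borel_measurable cswap).
Qed.

HB.instance Definition _ (S T : ptopologicalType) :=
  isMeasurableFun.Build _ _ (borel (S * T)%type) (borel (T * S)%type)
    (@swap S T) (@measurable_swap S T).

Section causal_couplings.
Variables (R : realType) (V : finType) (e : rel V).

Local Notation prob T := (probability (borel T) R).

(* The set P^G of G-compatible measures: the vertex v is attached to the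
   coordinate map x |-> x v. *)
Definition compatible_measure (X : V -> ptopologicalType)
    (mu : prob (prod_topology X)) : Prop :=
  graph_compatible (Omega := borel (prod_topology X))
    (fun v (x : prod_topology X) => x v) mu e.

Definition coupling (S T : ptopologicalType) (mu : prob S) (nu : prob T)
    (pi : prob (S * T)%type) : Prop :=
  (forall B : set (borel S), measurable B -> pi (fst @^-1` B) = mu B) /\
  (forall B : set (borel T), measurable B -> pi (snd @^-1` B) = nu B).

Section two_families.
Variables X Y : V -> ptopologicalType.

Definition family_sum (a : V + V) : ptopologicalType :=
  match a with inl i => X i | inr i => Y i end.

(* Coordinates of (x, y), which identify the product of the spaces X and Y with
   the product of [family_sum] over the vertices of [causal_graph]. *)
Definition coord_sum (a : V + V)
    (z : (prod_topology X * prod_topology Y)%type) : family_sum a :=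
  match a with inl i => z.1 i | inr i => z.2 i end.

Definition causal_coupling (mu : prob (prod_topology X))
    (nu : prob (prod_topology Y))
    (pi : prob (prod_topology X * prod_topology Y)%type) : Prop :=
  coupling mu nu pi /\
  graph_compatible
    (Omega := borel (prod_topology X * prod_topology Y)%type)
    coord_sum pi (causal_graph e).

End two_families.

Definition anticausal_coupling (X Y : V -> ptopologicalType)
    (mu : prob (prod_topology X)) (nu : prob (prod_topology Y))
    (pi : prob (prod_topology X * prod_topology Y)%type) : Prop :=
  coupling mu nu pi /\
  causal_coupling nu mu
    (distribution pi (@swap (prod_topology X) (prod_topology Y))).

Definition bicausal_coupling (X Y : V -> ptopologicalType)
    (mu : prob (prod_topology X)) (nu : prob (prod_topology Y))
    (pi : prob (prod_topology X * prod_topology Y)%type) : Prop :=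
  causal_coupling mu nu pi /\ anticausal_coupling mu nu pi.

Variables (X : V -> ptopologicalType).
Variable dX : prod_topology X -> prod_topology X -> R.

Definition finite_first_moment (mu : prob (prod_topology X)) : Prop :=
  exists x0, (\int[mu]_x (dX x x0)%:E < +oo)%E.

Definition compatible_measure1 (mu : prob (prod_topology X)) : Prop :=
  compatible_measure mu /\ finite_first_moment mu.

Definition causal_wasserstein1 (mu nu : prob (prod_topology X)) : \bar R :=
  ereal_inf [set (\int[pi]_z (dX z.1 z.2)%:E)%E
            | pi in [set pi | bicausal_coupling mu nu pi]].

End causal_couplings.

Section decision_problem.
Variables (R : realType) (n : nat) (X : 'I_n -> ptopologicalType).
Variable e : rel 'I_n.

Definition product_set (Ak : 'I_n -> set R) : set 'rV[R]_n :=
  [set a | forall k, Ak k (a ord0 k)].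

(* sigma(X_k, X_pa(k)) on the canonical space. *)
Definition sigma_vertex_pa (k : 'I_n) : set (set (borel (prod_topology X))) :=
  let xi := fun v (x : borel (prod_topology X)) => (x : prod_topology X) v in
  <<s sigma1 xi k `|` sigma_sub xi (pa e k) >>.

Definition adapted_action (Ak : 'I_n -> set R)
    (alpha : prod_topology X -> 'rV[R]_n) : Prop :=
  forall k,
    (forall x, Ak k (alpha x ord0 k)) /\
    (forall B : set R, measurable B ->
       sigma_vertex_pa k [set x | B (alpha x ord0 k)]).

(* Q is only relevant on the product set of the Ak; its integrals exist in
   [0, +oo] since Q is nonnegative there. *)
Definition value (Ak : 'I_n -> set R)
    (Q : prod_topology X -> 'rV[R]_n -> R)
    (mu : probability (borel (prod_topology X)) R) : \bar R :=
  ereal_inf [set (\int[mu]_x (Q x (alpha x))%:E)%E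
            | alpha in [set alpha | adapted_action Ak alpha]].

End decision_problem.

(* Main.v *)
Require Import Defs.
From HB Require Import structures.
From mathcomp Require Import all_boot all_order all_algebra.
From mathcomp Require Import all_classical all_reals all_analysis.
From mathcomp Require Import measurable_realfun.
From mathcomp Require Import ring lra.

Set Implicit Arguments.
Unset Strict Implicit.
Unset Printing Implicit Defensive.

Import Order.TTheory GRing.Theory Num.Theory.
Import numFieldNormedType.Exports.

Local Open Scope classical_set_scope.
Local Open Scope ring_scope.

(* Let pi be a causal coupling of mu and nu, and alpha an action for nu. Put
   beta_k(X) = E_pi[alpha_k(Y) | X_k, X_pa(k)]. Since the graph is transitively
   closed, enumerating {k} and pa(k) in increasing order and using causality at
   each copy i' shows that (Y_k, Y_pa(k)) and X are independent given X_k and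
   X_pa(k); hence beta = E_pi[alpha(Y) | X], and by the conditional Jensen
   inequality

     v(mu) <= E[Q(X, beta(X))] <= E_pi[Q(X, alpha(Y))]
           <= E_nu[Q(Y, alpha(Y))] + L E_pi[d(X, Y)].

   The other inequality is this one for the swapped coupling. As Q(x, .) may be
   discontinuous at the boundary of the box A, alpha is first rounded to finitely
   many values, each a convex combination of alpha (with weight close to 1) and of
   another point of A; Jensen's inequality is then a finite sum. *)

(** * Integrals and conditional probabilities *)

(* The integral of a nonnegative function is the supremum of the integrals of the
   simple functions below it, hence a lower integral when the function is not
   measurable, as may be the case of the cost [Q x (alpha x)]. *)
Section lower_integral.
Local Open Scope ereal_scope.
Context d (T : measurableType d) (R : realType).
Variable mu : {measure set T -> \bar R}.
Implicit Types f g : T -> \bar R.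

(** Whether [Q x (alpha x)] is measurable is left open, so costs are lower integrals. These are
    superadditive, whereas the argument needs upper bounds for sums. Rounded actions serve as
    measurable intermediaries: they take finitely many values, and [Q] is continuous in [x] for each
    fixed action. Finitely many values also allow conditional expectations to be replaced by
    conditional probabilities of events, that is, by Radon-Nikodym densities; E[f | phi] =
    E[g | phi] is read as equality of the integrals over all preimages under [phi]. The parents of a
    copy i' are i, pa(i) and the copies of pa(i). Since {k} with pa(k) is closed under parents, the
    coordinates of X in this set and the copies already treated include all that compatibility at
    the next copy conditions on. What is carried along this enumeration is the conditional
    probability of an event of X: it stays the same when one more Y_i is adjoined to the
    conditioning. *)

Lemma le_lower_integral f g : (forall x, 0 <= f x) ->
  (forall x, f x <= g x) -> \int[mu]_x f x <= \int[mu]_x g x.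
Proof.
move=> f0 fg.
have g0 x : 0 <= g x by apply: le_trans (fg x).
rewrite !ge0_integralTE//; apply: le_ereal_sup => _ [h hf <-].
by exists h => // x; apply: le_trans (fg x).
Qed.

(** Raising [g] to +oo on the null set where the inequality may fail does not change its integral
    and gives a bound at every point, so that monotonicity applies to a possibly non-measurable
    [f]. *)
Lemma ae_le_lower_integral f g : (forall x, 0 <= f x) -> (forall x, 0 <= g x) ->
  measurable_fun setT g -> {ae mu, forall x, f x <= g x} ->
  \int[mu]_x f x <= \int[mu]_x g x.
Proof.
move=> f0 g0 mg [N [mN muN subN]].
pose G x := if x \in N then +oo else g x.
have mG : measurable_fun setT G.
  apply: measurable_fun_ifT => //; apply: (measurable_fun_bool true).
  rewrite setTI (_ : _ @^-1` _ = N)//.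
  by apply/seteqP; split => x /= => [/set_mem|/mem_set].
have G0 x : 0 <= G x by rewrite /G; case: ifP.
have -> : \int[mu]_x g x = \int[mu]_x G x.
  apply: ge0_ae_eq_integral => //; exists N; split=> // x /= h.
  apply: contrapT => xN; apply: h => _; rewrite /G ifF//.
  by apply/negbTE; rewrite notin_setE.
apply: le_lower_integral => // x; rewrite /G; case: ifPn => [_|]; first exact: leey.
by rewrite notin_setE => xN; apply: contrapT => h; apply: xN; exact: subN.
Qed.

(** The positive part of [q - g] is measurable and lies below [f], so its integral is at most the
    lower integral of [f]. In the application [q] is the rounded cost, [f] the original one and [g]
    the rounding error. *)
Lemma lower_integralD_ge (f g q : T -> R) : (forall x, (0 <= f x)%R) ->
  (forall x, (0 <= g x)%R) -> (forall x, (0 <= q x)%R) ->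
  measurable_fun setT g -> measurable_fun setT q ->
  (forall x, (q x <= f x + g x)%R) ->
  \int[mu]_x (q x)%:E <= \int[mu]_x (f x)%:E + \int[mu]_x (g x)%:E.
Proof.
move=> f0 g0 q0 mg mq qfg.
pose r x := Num.max (q x - g x)%R 0%R.
have mr : measurable_fun setT r.
  by apply: measurable_maxr => //; exact: measurable_funB.
have r0 x : (0 <= r x)%R by rewrite /r le_max lexx orbT.
apply: (@le_trans _ _ (\int[mu]_x ((r x)%:E + (g x)%:E))).
  apply: le_lower_integral => x; first by rewrite lee_fin.
  by rewrite -EFinD lee_fin /r -lerBlDr le_max lexx.
rewrite ge0_integralD//; [|by move=> x _; rewrite lee_fin|exact/measurable_EFinP|
  by move=> x _; rewrite lee_fin|exact/measurable_EFinP].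
apply: leeD => //; apply: le_lower_integral => x; first by rewrite lee_fin.
by rewrite lee_fin /r ge_max f0 andbT lerBlDr.
Qed.

End lower_integral.

Section same_conditional_integrals.
Local Open Scope ereal_scope.
Context d d' (T : measurableType d) (T' : measurableType d') (R : realType).
Variables (mu : {measure set T -> \bar R}) (phi : T -> T').
Hypothesis mphi : measurable_fun setT phi.

Let mphiV A : measurable A -> measurable (phi @^-1` A).
Proof. by move=> mA; rewrite -[X in measurable X]setTI; exact: mphi. Qed.

Import HBNNSimple.

Let integral_nnsfunM (f : T -> R) (h : {nnsfun T' >-> R}) :
  (forall x, (0 <= f x)%R) -> measurable_fun setT f ->
  \int[mu]_x (h (phi x) * f x)%:E =
  \sum_(y \in range h) (y%:E * \int[mu]_(x in phi @^-1` (h @^-1` [set y])) (f x)%:E).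
Proof.
move=> f0 mf.
have mpre y : measurable (phi @^-1` (h @^-1` [set y])) by exact: mphiV.
have mind y : measurable_fun setT (fun x => (y * \1_(h @^-1` [set y]) (phi x))%R).
  by apply: measurable_funM => //; apply: measurableT_comp.
have ge0 y x : range h y -> (0 <= y * \1_(h @^-1` [set y]) (phi x))%R.
  by move=> [z _ <-]; rewrite mulr_ge0.
transitivity (\int[mu]_x (\sum_(y \in range h)
    (y * \1_(h @^-1` [set y]) (phi x) * f x)%:E)).
  apply: eq_integral => x _; rewrite fsumEFin//.
  by rewrite [in LHS](fimfunE h) mulr_fsuml.
transitivity (\sum_(y \in range h)
  \int[mu]_x (y * \1_(h @^-1` [set y]) (phi x) * f x)%:E).
  rewrite (@ge0_integral_fsum _ _ _ mu setT measurableT _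
    (fun y x => (y * \1_(h @^-1` [set y]) (phi x) * f x)%:E))//.
  - by move=> y; apply/measurable_EFinP/measurable_funM.
  - move=> y x _; rewrite lee_fin mulr_ge0//.
    have [hy|hy] := pselect (range h y); first exact: ge0.
    rewrite (_ : h @^-1` [set y] = set0) ?indic0 ?mulr0//.
    by apply/seteqP; split => // z /= hz; apply: hy; exists z.
apply: eq_fsbigr => y; rewrite inE => yh.
rewrite -ge0_integralZl//; last 3 first.
- by apply/measurable_EFinP; exact: measurable_funS mf.
- by move=> x _; rewrite lee_fin.
- by move: yh => [z _ <-]; rewrite lee_fin.
rewrite [RHS]integral_mkcond; apply: eq_integral => x _.
rewrite patchE; case: ifPn => hx; rewrite -?EFinM; congr EFin.
  by rewrite indicE (_ : _ \in _ = true) ?mulr1//.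
by rewrite indicE (_ : _ \in _ = false) ?mulr0 ?mul0r//; exact/negbTE.
Qed.

(** The hypothesis says that [f] and [g] have the same conditional expectation given [phi]; a factor
    depending on [phi] may then be inserted. This is linear in [h], clear for simple functions and
    stable under increasing limits; nonnegativity makes infinite integrals harmless. *)
Lemma integralM_eq (f g : T -> R) (h : T' -> R) :
  (forall x, (0 <= f x)%R) -> (forall x, (0 <= g x)%R) ->
  (forall x, (0 <= h x)%R) ->
  measurable_fun setT f -> measurable_fun setT g -> measurable_fun setT h ->
  (forall A, measurable A -> \int[mu]_(x in phi @^-1` A) (f x)%:E =
                             \int[mu]_(x in phi @^-1` A) (g x)%:E) ->
  \int[mu]_x (h (phi x) * f x)%:E = \int[mu]_x (h (phi x) * g x)%:E.
Proof.
move=> f0 g0 h0 mf mg mh fg.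
have mhE : measurable_fun setT (EFin \o h) by exact/measurable_EFinP.
pose hn := nnsfun_approx measurableT mhE.
have lim (k : T -> R) : (forall x, (0 <= k x)%R) -> measurable_fun setT k ->
  \int[mu]_x (h (phi x) * k x)%:E =
    limn (fun n => \int[mu]_x (hn n (phi x) * k x)%:E).
  move=> k0 mk; rewrite -monotone_convergence//.
  - apply: eq_integral => x _; apply/esym/cvg_lim => //.
    rewrite EFinM; under eq_fun do rewrite EFinM.
    apply: cvgeZr => //.
    by apply: (cvg_nnsfun_approx measurableT mhE) => // y _ /=; rewrite lee_fin.
  - move=> n; apply/measurable_EFinP/measurable_funM => //.
    exact: measurableT_comp.
  - by move=> n x _; rewrite lee_fin mulr_ge0.
  - move=> x _ a b ab; rewrite lee_fin ler_wpM2r//.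
    exact/lefP/nd_nnsfun_approx.
rewrite !lim//; congr (limn _); apply/funext => n.
rewrite !integral_nnsfunM//; apply: eq_fsbigr => y _; congr (_ * _).
exact: fg.
Qed.

End same_conditional_integrals.

(** * Conditional probabilities as densities with respect to image measures *)

Section conditional_probability.
Local Open Scope ereal_scope.
Context d d' (T : measurableType d) (T' : measurableType d') (R : realType).
Variables (P : probability T R) (phi : {mfun T >-> T'}).

Let mphiV A : measurable A -> measurable (phi @^-1` A).
Proof. by move=> mA; rewrite -[X in measurable X]setTI; exact: measurable_funP. Qed.

(** Radon-Nikodym density, with respect to the law of [phi], of the measure sending D to P(A, phi in
    D). As a function on the target it factors through [phi] by construction. Two kinds of [phi]
    occur: the identity onto a coarser sigma-algebra, and a projection of the coupling. *)
Lemma conditional_probability_exists (A : set T) : measurable A ->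
  exists p : T' -> R, [/\ measurable_fun setT p, forall y, (0 <= p y)%R &
    forall D, measurable D ->
      P (A `&` phi @^-1` D) = \int[P]_(x in phi @^-1` D) (p (phi x))%:E].
Proof.
move=> mA.
pose m0 := mrestr P mA.
pose nu0 : set T' -> \bar R := pushforward m0 phi.
have nu00 : nu0 set0 = 0 by rewrite /nu0 /m0 /pushforward /mrestr preimage_set0 set0I measure0.
have nu0_ge0 B : 0 <= nu0 B by exact: measure_ge0.
have nu0_add : semi_sigma_additive nu0.
  move=> F mF tF mU; rewrite /nu0 /pushforward preimage_bigcup.
  apply: (@measure_semi_sigma_additive _ _ _ (mrestr P mA)).
  - by move=> n; exact: mphiV.
  - apply/trivIsetP => /= i j _ _ ij; rewrite -preimage_setI.
    by move/trivIsetP : tF => /(_ _ _ _ _ ij) ->//; rewrite preimage_set0.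
  - by rewrite -preimage_bigcup; exact: mphiV.
have nu0_fin : fin_num_fun nu0.
  by move=> B mB; rewrite /nu0 /pushforward /m0 /mrestr fin_num_measure//;
    apply: measurableI => //; exact: mphiV.
pose mx := isMeasure.Build _ _ _ nu0 nu00 nu0_ge0 nu0_add.
pose nu1 : {measure set T' -> \bar R} := HB.pack nu0 mx.
pose fx := Measure_isFinite.Build _ _ _ nu1 nu0_fin.
pose nu : {finite_measure set T' -> \bar R} := HB.pack nu0 mx fx.
have dom : nu `<< (distribution P phi : {measure set T' -> \bar R}).
  apply/null_content_dominatesP => B mB PB0; rewrite /nu /= /nu0 /pushforward /m0 /mrestr.
  apply/eqP; rewrite eq_le measure_ge0 andbT -PB0.
  by apply: le_measure; rewrite ?inE//; [apply: measurableI => //; exact: mphiV|exact: mphiV].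
have [f [f0 ffin intf fE]] := radon_nikodym_sigma_finite dom.
have mf := measurable_int _ intf.
have fK y : f y = (fine (f y))%:E by rewrite fineK.
exists (fun y => fine (f y)); split => //.
- by move=> /= ; apply: measurableT_comp => //.
- by move=> y; rewrite fine_ge0.
- move=> D mD; have /= := fE _ mD; rewrite /nu0 /pushforward /m0 /mrestr setIC => ->.
  rewrite ge0_integral_pushforward//; last exact: measurable_funS mf.
  by apply: eq_integral => x _ /=; rewrite -fK.
Qed.

Lemma ae_eq_of_integral (f g : T' -> R) :
  measurable_fun setT f -> measurable_fun setT g ->
  P.-integrable setT (fun x => (f (phi x))%:E) ->
  (forall D, measurable D -> \int[P]_(x in phi @^-1` D) (f (phi x))%:E =
                             \int[P]_(x in phi @^-1` D) (g (phi x))%:E) ->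
  {ae P, forall x, f (phi x) = g (phi x)}.
Proof.
move=> mf mg intf fg.
have intg : P.-integrable setT (fun x => (g (phi x))%:E).
  have mgp : measurable_fun setT (fun x => (g (phi x))%:E).
    by apply/measurable_EFinP; exact: measurableT_comp.
  (* A finite integral forces integrability, because a difference of two infinite parts is again
     infinite by convention; the total integral of [g] is that of [f]. *)
  apply/integrableP; split => //; apply/abse_integralP => //.
  rewrite -(preimage_setT phi) -fg// preimage_setT; apply/abse_integralP => //.
    exact: measurable_int intf.
  by case/integrableP : intf.
have mfE : measurable_fun setT (EFin \o f) by exact/measurable_EFinP.
have mgE : measurable_fun setT (EFin \o g) by exact/measurable_EFinP.
have push (h : T' -> R) D : measurable_fun setT h ->  measurable D ->
   P.-integrable setT (fun x => (h (phi x))%:E) ->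
   \int[distribution P phi]_(y in D) (h y)%:E = \int[P]_(x in phi @^-1` D) (h (phi x))%:E.
  move=> mh mD inth; rewrite integral_pushforward//.
    exact/measurable_EFinP.
  apply: integrableS inth => //; exact: mphiV.
have [N [mN PN0 subN]] : ae_eq (distribution P phi) setT (EFin \o f) (EFin \o g).
  apply: integral_ae_eq => //.
    by apply: integrable_pushforward; rewrite ?preimage_setT.
  by move=> E _ mE; rewrite !push// fg.
exists (phi @^-1` N); split => //; first exact: mphiV.
by move=> x /= fgx; apply: subN => /= h; apply: fgx; have [] := h Logic.I.
Qed.

End conditional_probability.

(** * Conditioning on sub-sigma-algebras and on their joins *)

Section sub_sigma_algebras.
Context d (T : measurableType d) (R : realType).

Lemma sub_measurable_id (G : set (set T)) : G `<=` measurable ->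
  measurable_fun setT (idfun : T -> g_sigma_algebraType G).
Proof.
move=> Gm _ A mA; rewrite setTI preimage_id.
by apply: (smallest_sub (@sigma_algebra_measurable _ T) Gm).
Qed.

Lemma sub_measurable_fun d' (T' : measurableType d') (G : set (set T)) (f : T -> T') :
  G `<=` measurable ->
  measurable_fun setT (f : g_sigma_algebraType G -> T') -> measurable_fun setT f.
Proof.
move=> Gm mf _ A mA; rewrite setTI.
apply: (smallest_sub (@sigma_algebra_measurable _ T) Gm).
by rewrite -[X in _ X]setTI; exact: mf.
Qed.

Lemma sub_sigma_measurable_fun d' (T' : measurableType d') (G H : set (set T)) (f : T -> T') :
  <<s G >> `<=` <<s H >> ->
  measurable_fun setT (f : g_sigma_algebraType G -> T') ->
  measurable_fun setT (f : g_sigma_algebraType H -> T').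
Proof.
by move=> GH mf _ A mA; apply: GH; exact: mf.
Qed.

Local Open Scope ereal_scope.
Variable P : probability T R.

Lemma integral_indicM (A : set T) (f : T -> R) : measurable A ->
  \int[P]_x (\1_A x * f x)%:E = \int[P]_(x in A) (f x)%:E.
Proof.
move=> mA; rewrite [RHS]integral_mkcond; apply: eq_integral => x _.
rewrite patchE indicE; case: (x \in A); first by rewrite mul1r.
by rewrite mul0r.
Qed.

Lemma probI_integral (A D : set T) : measurable A -> measurable D ->
  P (A `&` D) = \int[P]_(x in A) (\1_D x)%:E.
Proof. by move=> mA mD; rewrite integral_indic// setIC. Qed.

Lemma ge0_le1_integrable (f : T -> R) : measurable_fun setT f ->
  (forall x, (0 <= f x)%R) -> \int[P]_x (f x)%:E <= 1 ->
  P.-integrable setT (EFin \o f).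
Proof.
move=> mf f0 f1; apply/integrableP; split; first exact/measurable_EFinP.
apply: (@le_lt_trans _ _ 1); last exact: ltry.
by under eq_integral => x _ do rewrite /= ger0_norm//.
Qed.

(* Conditional independence given C, in the form: some version of P(A | C) is also
   a version of P(A | G). *)
Lemma cond_indep_integral (F G C : set (set T)) :
  cond_indep P F G C -> sigma_algebra setT C -> C `<=` G -> G `<=` measurable ->
  F `<=` measurable ->
  forall A, F A -> exists g : T -> R,
    [/\ measurable_fun setT (g : g_sigma_algebraType C -> R),
        forall x, (0 <= g x)%R &
        forall E, G E -> P (A `&` E) = \int[P]_(x in E) (g x)%:E].
Proof.
move=> FGC sC CG Gm Fm A FA.
have mC : <<s C >> = C by exact: sigma_algebra_id.
have Cm : C `<=` measurable by exact: subset_trans Gm.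
(* Conditioning on [C] is conditioning on the identity map, seen as a map onto the same space with
   the coarser measurable structure. *)
pose ix := isMeasurableFun.Build _ _ _ _ _ (sub_measurable_id Cm).
pose phi : {mfun T >-> g_sigma_algebraType C} := HB.pack (idfun : T -> g_sigma_algebraType C) ix.
have mCT : C setT by rewrite -mC; exact: (@measurableT _ (g_sigma_algebraType C)).
have [p [mp p0 pE]] := conditional_probability_exists P phi (Fm _ FA).
have mp' : measurable_fun setT (p : T -> R) by exact: sub_measurable_fun mp.
exists p; split => // E GE.
have [r [mr r0 rE]] := conditional_probability_exists P phi (Gm _ GE).
have mr' : measurable_fun setT (r : T -> R) by exact: sub_measurable_fun mr.
have [f [g [h [[Cf If fE] [Cg Ig gE] [Ch Ih hE] hfg]]]] := FGC A E FA GE.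
have Cmeas (k : T -> R) : (forall B, measurable B -> C (k @^-1` B)) ->
    measurable_fun setT (k : g_sigma_algebraType C -> R).
  by move=> Ck _ B mB; rewrite setTI; apply: sub_sigma_algebra; exact: Ck.
have mh : measurable_fun setT h by apply: (sub_measurable_fun Cm); exact: Cmeas.
have mA := Fm _ FA. have mE := Gm _ GE.
(* The versions provided by [cond_indep] are arbitrary; almost sure uniqueness identifies them with
   [p] and [r]. *)
have fp : {ae P, forall x, f x = p x}.
  apply: (ae_eq_of_integral (phi := phi) (Cmeas _ Cf) mp) => //= D.
  by rewrite /measurable/= mC preimage_id => CD; rewrite fE// pE// /measurable/= mC.
have gr : {ae P, forall x, g x = r x}.
  apply: (ae_eq_of_integral (phi := phi) (Cmeas _ Cg) mr) => //= D.
  by rewrite /measurable/= mC preimage_id => CD; rewrite gE// rE// /measurable/= mC.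
have -> : P (A `&` E) = \int[P]_x (h x)%:E by rewrite hE// setIT.
rewrite (_ : \int[P]_x (h x)%:E = \int[P]_x (p x * r x)%:E); last first.
  apply: ae_eq_integral => //; first exact/measurable_EFinP.
    by apply/measurable_EFinP; exact: measurable_funM.
  apply: filterS3 hfg fp gr => x /= -> -> -> //.
have i0 x : (0 <= \1_E x :> R)%R by rewrite indicE.
have mi : measurable_fun setT (\1_E : T -> R) by exact: measurable_indic.
(* E[p r] = E[p 1_E], because [p] is measurable for [C] and [r] is a version of P(E | C). *)
rewrite (integralM_eq (sub_measurable_id Cm) r0 i0 p0 mr' mi mp).
  by rewrite -integral_indicM//; apply: eq_integral => x _; rewrite mulrC.
move=> D mD; have CD : C D by rewrite -mC.
rewrite -probI_integral; [|exact: (Cm D CD)|exact: mE].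
by have := rE _ mD; rewrite preimage_id setIC => ->.
Qed.

(** Both sides are measures in [A], finite with the same total mass because [G] contains the whole
    space; hence the sets of agreement are closed under complements and disjoint unions, and the
    pi-lambda theorem applies. *)
Lemma agree_dynkin (G : set (set T)) (D : set T) (q : T -> R) :
  G `<=` measurable -> setI_closed G -> G setT ->
  measurable D -> measurable_fun setT q -> (forall x, (0 <= q x)%R) ->
  (forall A, G A -> P (A `&` D) = \int[P]_(x in A) (q x)%:E) ->
  forall A, <<s G >> A -> P (A `&` D) = \int[P]_(x in A) (q x)%:E.
Proof.
move=> Gm GI GT mD mq q0 GE.
have Gm' : <<s G >> `<=` measurable.
  exact: (smallest_sub (@sigma_algebra_measurable _ T) Gm).
have mqE (A : set T) : measurable_fun A (EFin \o q).
  by apply/measurable_EFinP; exact: measurable_funTS.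
have := @dynkin_induction _ (g_sigma_algebraType G) G
  (fun A => P (A `&` D) = \int[P]_(x in A) (q x)%:E).
apply => //; first exact: GE.
- move=> S mS SE.
  have mST : measurable (S : set T) by exact: Gm'.
  have PT := GE _ GT; rewrite setTI in PT.
  have Sfin : P (S `&` D) \is a fin_num by rewrite fin_num_measure//; exact: measurableI.
  rewrite -[LHS](addeK _ Sfin) -[RHS](addeK _ Sfin); congr (_ - _).
  rewrite addeC [RHS]addeC [in RHS]SE.
  rewrite -measureU//; last 3 first.
  - exact: measurableI.
  - by apply: measurableI => //; exact: measurableC.
  - by rewrite setIACA setICr set0I.
  rewrite -ge0_integral_setU//; last 3 first.
  - exact: measurableC.
  - by move=> x _; rewrite lee_fin.
  - exact/disj_setPCl.
  by rewrite -setIUl setUCr setTI.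
- move=> F mF tF FE.
  have mFT n : measurable (F n : set T) := Gm' _ (mF n).
  rewrite setI_bigcupl measure_bigcup//; last 2 first.
  - by move=> n _; exact: measurableI.
  - by apply: trivIset_setIr.
  rewrite ge0_integral_bigcup//; last by move=> x _; rewrite lee_fin.
  rewrite (@eq_eseriesl _ _ xpredT) => [|n]; last by rewrite mem_setT.
  by apply: eq_eseriesr => n _; exact: FE.
Qed.

(* In the application q = P(D | C) with C contained in H. Both sides are measures in
   A, so that no conditional probability of A is needed to pass from H to the join
   of H and F. *)
Lemma agree_join (H F N : set (set T)) (D : set T) (q : T -> R) :
  H `<=` measurable -> N `<=` measurable -> F `<=` measurable ->
  <<s H >> `<=` <<s N >> -> setI_closed F -> F setT ->
  <<s N >> D -> measurable_fun setT (q : g_sigma_algebraType N -> R) ->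
  (forall x, (0 <= q x)%R) ->
  (forall A, <<s H >> A -> P (A `&` D) = \int[P]_(x in A) (q x)%:E) ->
  (forall A, F A -> exists g : T -> R,
    [/\ measurable_fun setT (g : g_sigma_algebraType H -> R),
        forall x, (0 <= g x)%R &
        forall E, <<s N >> E -> P (A `&` E) = \int[P]_(x in E) (g x)%:E]) ->
  forall A, <<s H `|` F >> A -> P (A `&` D) = \int[P]_(x in A) (q x)%:E.
Proof.
move=> Hm Nm Fm HN FI FT ND mq q0 HE FE A HFA.
have sm (G : set (set T)) : G `<=` measurable -> <<s G >> `<=` measurable.
  by move=> Gm; exact: (smallest_sub (@sigma_algebra_measurable _ T) Gm).
have mD := sm _ Nm _ ND.
have mqT : measurable_fun setT q by exact: sub_measurable_fun mq.
(* A pi-system that generates the join. *)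
pose G := [set B | exists A1 A2, [/\ <<s H >> A1, F A2 & B = A1 `&` A2]].
have HT : <<s H >> setT by exact: (@measurableT _ (g_sigma_algebraType H)).
have := @agree_dynkin G D q; apply => //.
- by move=> _ [A1 [A2 [HA1 FA2 ->]]]; apply: measurableI; [exact: sm HA1|exact: Fm].
- move=> _ _ [A1 [A2 [HA1 FA2 ->]]] [B1 [B2 [HB1 FB2 ->]]].
  exists (A1 `&` B1), (A2 `&` B2); split; last by rewrite setIACA.
    exact: (@measurableI _ (g_sigma_algebraType H)).
  exact: FI.
- by exists setT, setT; split => //; rewrite setIT.
- move=> _ [A1 [A2 [HA1 FA2 ->]]].
  have [g [mg g0 gE]] := FE _ FA2.
  have mA1 := sm _ Hm _ HA1; have mA2 := Fm _ FA2.
  have mgT : measurable_fun setT g by exact: sub_measurable_fun mg.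
  have mgN := sub_sigma_measurable_fun HN mg.
  have mindN B : <<s N >> B -> measurable_fun setT (\1_B : g_sigma_algebraType N -> R).
    by move=> NB; exact: measurable_indic.
  have mindH : measurable_fun setT (\1_A1 : g_sigma_algebraType H -> R).
    exact: measurable_indic.
  have i0 (B : set T) x : (0 <= \1_B x :> R)%R by rewrite indicE.
  have Nswap (h : T -> R) : measurable_fun setT (h : g_sigma_algebraType N -> R) ->
      (forall x, (0 <= h x)%R) ->
      \int[P]_x (h x * \1_A2 x)%:E = \int[P]_x (h x * g x)%:E.
    move=> mh h0.
    have mi : measurable_fun setT (\1_A2 : T -> R) by exact: measurable_indic.
    refine (integralM_eq (sub_measurable_id Nm) (i0 A2) g0 h0 mi mgT mh _).
    move=> E NE; rewrite preimage_id -gE//.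
    by rewrite setIC probI_integral//; exact: sm NE.
  have Hswap (h : T -> R) : measurable_fun setT (h : g_sigma_algebraType H -> R) ->
      (forall x, (0 <= h x)%R) ->
      \int[P]_x (h x * \1_D x)%:E = \int[P]_x (h x * q x)%:E.
    move=> mh h0.
    have mi : measurable_fun setT (\1_D : T -> R) by exact: measurable_indic.
    refine (integralM_eq (sub_measurable_id Hm) (i0 D) q0 h0 mi mqT mh _).
    by move=> E NE; rewrite preimage_id -HE// probI_integral//; exact: sm NE.
  have mA12 : measurable (A1 `&` A2) by exact: measurableI.
  (* The computation is E[1_A1 1_D 1_A2] = E[1_A1 1_D g] = E[1_A1 q g] = E[1_A1 q 1_A2]. The outer
     equalities replace 1_A2 by [g] against factors measurable for [N]; the middle one replaces 1_D
     by [q] against 1_A1 g, which is measurable for [H]. *)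
  have -> : P (A1 `&` A2 `&` D) = \int[P]_x (\1_A1 x * \1_D x * \1_A2 x)%:E.
    rewrite probI_integral// -integral_indicM//; apply: eq_integral => x _.
    by rewrite indicI/= mulrAC.
  rewrite Nswap; last 2 first.
  - by apply: measurable_funM; apply: mindN => //; exact: HN.
  - by move=> x; rewrite mulr_ge0.
  under eq_integral => x _ do rewrite mulrAC.
  rewrite Hswap; last 2 first.
  - exact: measurable_funM.
  - by move=> x; rewrite mulr_ge0.
  under eq_integral => x _ do rewrite mulrAC.
  rewrite -(Nswap (fun x => \1_A1 x * q x)%R); last 2 first.
  - by apply: measurable_funM => //; apply: mindN; exact: HN.
  - by move=> x; rewrite mulr_ge0.
  rewrite -integral_indicM//; apply: eq_integral => x _.
  by rewrite indicI/= mulrAC.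
- apply: smallest_sub HFA => [|B [HB|FB]]; first exact: smallest_sigma_algebra.
    by apply: sub_sigma_algebra; exists B, setT; split => //;
      [exact: sub_sigma_algebra|rewrite setIT].
  by apply: sub_sigma_algebra; exists setT, B; split => //; rewrite setTI.
Qed.

End sub_sigma_algebras.

(** * Borel sets of finite products of Polish spaces *)

Section countable_bases.

Definition countable_base (T : topologicalType) (b : nat * nat -> set T) :=
  (forall k, open (b k)) /\
  forall x U, nbhs x U -> exists k, b k x /\ b k `<=` U.

Lemma metric_ball_open (R : realType) (T : topologicalType) (d : T -> T -> R) x r :
  is_metric d -> induces_topology d -> open [set y | d x y < r].
Proof.
move=> [d0 dC dT] dtop; rewrite openE => y /= xy; apply/dtop.
exists (r - d x y); first by rewrite subr_gt0.
by move=> z /=; rewrite ltrBrDl; exact: le_lt_trans.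
Qed.

Lemma polish_countable_base (R : realType) (T : ptopologicalType) :
  polish R T -> exists b, @countable_base T b.
Proof.
move=> [[D cD dD] [d [md td _]]]; have [d0 dC dT] := md.
have [c [_ Dc]] : exists c : nat -> T, True /\ forall x, D x -> exists n, c n = x.
  have [D0|[f]] := pfcard_geP cD.
    by exists (fun=> point); split=> // x; rewrite D0.
  by exists f; split => // x /(@surj _ _ _ _ f)[n _ fn]; exists n.
exists (fun k => [set y | d (c k.1) y < k.2.+1%:R^-1]); split=> [k|x U /td[r r0 rU]].
  exact: metric_ball_open.
have [m mr] : exists m : nat, m.+1%:R^-1 < r / 2.
  have [m] := near_infty_natSinv_lt (PosNum (divr_gt0 r0 (ltr0Sn R 1))).
  by move=> _ /(_ m (leqnn m)) /= h; exists m.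
have /dD[] : [set y | d x y < m.+1%:R^-1] !=set0.
  by exists x; rewrite /= (d0 _ _).2// invr_gt0.
  exact: metric_ball_open.
move=> z [/= xz /Dc[n cn]]; exists (n, m); split => /=.
  by rewrite cn dC.
move=> y /=; rewrite cn => zy; apply: rU => /=.
apply: (le_lt_trans (dT x z y)); rewrite [r]splitr.
by apply: ltrD; [exact: lt_trans mr|exact: lt_trans mr].
Qed.

(** The product topology is a supremum of topologies pulled back from the coordinates, and
    convergence to [x] can be tested in each of them. So the sets that contain a basic box around
    [x] are shown to form a filter, and its convergence is checked one coordinate at a time. *)
Lemma nbhs_prod_box (I : finType) (X : I -> ptopologicalType)
    (b : forall i, nat * nat -> set (X i)) :
  (forall i, countable_base (b i)) ->
  forall (x : prod_topology X) U, nbhs x U ->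
    exists f : {ffun I -> nat * nat}, (forall i, b i (f i) (x i)) /\
      [set y : prod_topology X | forall i, b i (f i) (y i)] `<=` U.
Proof.
move=> bb x.
pose F : set_system (prod_topology X) := fun U =>
  exists f : {ffun I -> nat * nat}, (forall i, b i (f i) (x i)) /\
      [set y : prod_topology X | forall i, b i (f i) (y i)] `<=` U.
have FF : Filter F.
  split.
  - have [u uP] := choice (fun i => (bb i).2 (x i) setT filterT).
    by exists [ffun i => u i]; split => // i; rewrite ffunE; exact: (uP i).1.
  - move=> A B [f [fx fA]] [g [gx gB]].
    have h i : exists k, b i k (x i) /\ b i k `<=` b i (f i) `&` b i (g i).
      by apply: (bb i).2; apply: filterI; apply: open_nbhs_nbhs; split => //; exact: (bb i).1.
    have [u uP] := choice h; exists [ffun i => u i].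
    split=> [i|y /= uy]; first by rewrite ffunE; exact: (uP i).1.
    by split; [apply: fA|apply: gB] => i; have := uy i; rewrite ffunE => /(uP i).2 [].
  - by move=> A B AB [f [fx fA]]; exists f; split => //; exact: subset_trans AB.
suff : F --> (x : prod_topology X) by move=> Fx U /Fx.
apply/cvg_sup => i A [B [[C oC CB] Bx] BA].
have Cx : nbhs (x i) C by apply: open_nbhs_nbhs; split => //; move: Bx; rewrite /= -CB.
have [k [kx kC]] := (bb i).2 _ _ Cx.
apply: filterS BA _; rewrite -CB.
(* The constraint at [i] is an implication from [j = i], which avoids a cast between [X j] and
   [X i]. *)
have h j : exists k, b j k (x j) /\ (j = i -> forall y : prod_topology X, b j k (y j) -> C (y i)).
  have [->|ji] := eqVneq j i; first by exists k; split => // _ y /kC.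
  have [k' [k'x _]] := (bb j).2 (x j) setT filterT; exists k'; split => // ji'.
  by rewrite ji' eqxx in ji.
have [u uP] := choice h; exists [ffun j => u j].
split => [j|y /= uy]; first by rewrite ffunE; exact: (uP j).1.
by apply: (uP i).2 => //; have := uy i; rewrite ffunE.
Qed.

(** An open set is the union of the basic boxes it contains, and there are only countably many
    boxes. Thus measurability into the Borel sigma-algebra of the product can be tested on
    coordinates; without countable bases that sigma-algebra may be larger than the product one. *)
Lemma prod_borel_generated (R : realType) (I : finType) (X : I -> ptopologicalType)
    (Om : pointedType) (G : set (set Om)) (xi : forall i, Om -> X i) :
  (forall i, polish R (X i)) ->
  (forall i, measurable_fun setT (xi i : g_sigma_algebraType G -> borel (X i))) ->
  measurable_fun setT ((fun w i => xi i w) : g_sigma_algebraType G -> borel (prod_topology X)).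
Proof.
move=> pX mxi.
have [b bb] : exists b : forall i, nat * nat -> set (X i), forall i, countable_base (b i).
  exists (fun i => projT1 (cid (polish_countable_base (pX i)))) => i.
  exact: projT2 (cid _).
apply: measurability; first exact: (erefl <<s @open (prod_topology X) >>).
move=> _ [U oU <-]; rewrite setTI.
rewrite (_ : _ @^-1` _ = \bigcup_(f : {ffun I -> nat * nat})
   (if `[< [set y : prod_topology X | forall i, b i (f i) (y i)] `<=` U >] then
     \bigcap_i (xi i @^-1` b i (f i)) else set0)); last first.
  apply/seteqP; split => [w /= Uw|w [f _]].
    have [f [fw fU]] : exists f : {ffun I -> nat * nat}, (forall i, b i (f i) (xi i w)) /\
      [set y : prod_topology X | forall i, b i (f i) (y i)] `<=` U.
      by apply: (nbhs_prod_box bb (x := fun i => xi i w)); exact: open_nbhs_nbhs.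
    by exists f => //; rewrite asboolT// => i _; exact: fw.
  by case: asboolP => // fU h; apply: fU => i; exact: h.
apply: (@countable_bigcupT_measurable _ (g_sigma_algebraType G)) => // f.
case: asboolP => // _; apply: fin_bigcap_measurable => // i _.
rewrite -[X in measurable X]setTI; apply: mxi => //.
by apply: sub_sigma_algebra; exact: (bb i).1.
Qed.

End countable_bases.

Section coordinate_sigma_algebras.
Variables (R : realType) (V : finType) (X : V -> ptopologicalType).
Hypothesis polishX : forall v, polish R (X v).
Context d (Omega : measurableType d).
Variable xi : forall v, Omega -> X v.

(** A generating set, so that joins of sigma-algebras become unions of sets of vertices. *)
Definition coord_gen (B : {set V}) : set (set Omega) :=
  \bigcup_(v in [set v | v \in B]) sigma1 xi v.

Lemma coord_genS (B C : {set V}) : B \subset C -> coord_gen B `<=` coord_gen C.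
Proof. by move=> /fintype.subsetP BC A [v /= vB vA]; exists v => //=; exact: BC. Qed.

Lemma coord_gen_measurable (B : {set V}) v : v \in B ->
  measurable_fun setT (xi v : g_sigma_algebraType (coord_gen B) -> borel (X v)).
Proof.
move=> vB _ A mA; apply: sub_sigma_algebra; exists v => //.
by exists A.
Qed.

Lemma sigma_sub_sigma_algebra (B : {set V}) : sigma_algebra setT (sigma_sub xi B).
Proof. exact/sigma_algebra_preimage/sigma_algebra_measurable. Qed.

(** The inclusion from left to right rests on the countable bases; the other one only on continuity
    of the projections. *)
Lemma sigma_subE (B : {set V}) : sigma_sub xi B = <<s coord_gen B >>.
Proof.
apply/seteqP; split.
  have : measurable_fun setT ((@subvector _ X _ Omega xi B) :
      g_sigma_algebraType (coord_gen B) -> borel (subproduct X B)).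
    apply: (@prod_borel_generated R _ (fun v : {v : V | v \in B} => X (sval v)) _ _
      (fun v => xi (sval v))).
      by move=> i; exact: polishX.
    by move=> [v vB]; exact: coord_gen_measurable.
  by move=> mh _ [A mA <-]; exact: mh.
apply: smallest_sub; first exact: sigma_sub_sigma_algebra.
move=> _ [v vB [A mA <-]].
have cproj : continuous (fun y : subproduct X B => y (exist _ v vB)).
  exact: (@proj_continuous _ (fun v : {v : V | v \in B} => X (sval v))).
exists ((fun y : subproduct X B => y (exist _ v vB)) @^-1` A) => //.
by rewrite -[X in measurable X]setTI; exact: (continuous_borel_measurable cproj).
Qed.

Lemma coord_gen_sub_measurable (B : {set V}) :
  (forall v, measurable_fun setT (xi v : Omega -> borel (X v))) ->
  coord_gen B `<=` measurable.
Proof. by move=> mxi _ [v _ [A mA <-]]; exact: mxi. Qed.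

End coordinate_sigma_algebras.

(** * Conditional independence under causal couplings *)

Lemma sub_generated (T : Type) (G H : set (set T)) :
  G `<=` <<s H >> -> <<s G >> `<=` <<s H >>.
Proof. by move=> GH; apply: smallest_sub; first exact: smallest_sigma_algebra. Qed.

Section causal_graphs.
Variables (n : nat) (e : rel 'I_n).
Hypotheses (sorted_e : sorted_graph e) (closed_e : transitively_closed e).

Lemma causal_connect_inr (i : 'I_n) b : connect (causal_graph e) (inr i) b ->
  exists2 j : 'I_n, b = inr j & (i <= j)%N.
Proof.
case/connectP => p; elim: p i => [|[j|j] p IH] i /=.
- by move=> _ ->; exists i.
- by [].
- move=> /andP[ij /IH h] /h [l -> jl]; exists l => //.
  by apply: leq_trans jl; apply: ltnW; apply: sorted_e; rewrite inE.
Qed.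

(** No edge leads from a copy back to an original vertex, and indices increase along edges between
    copies. Consequently all of X and the earlier copies are nondescendants of i'. *)
Lemma causal_dsc_inr (i : 'I_n) b : b \in dsc (causal_graph e) (inr i) ->
  exists2 j : 'I_n, b = inr j & (i < j)%N.
Proof.
rewrite !inE => /existsP[[j|j] //= /andP[ij /causal_connect_inr[l -> jl]]].
by exists l => //; apply: leq_trans jl; apply: sorted_e; rewrite inE.
Qed.

(** The variables known after step m of the enumeration: X_B together with the Y_j for j in B below
    m. Stage 0 is X_B, stage n is X_B with Y_B. *)
Definition stage (B : {set 'I_n}) (m : nat) : {set 'I_n + 'I_n} :=
  [set a | match a with inl j => j \in B | inr j => (j \in B) && (j < m)%N end]%SET.

Definition lefts : {set 'I_n + 'I_n} := [set a | if a is inl _ then true else false]%SET.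

Definition nondesc (i : 'I_n) := (~: (inr i |: dsc (causal_graph e) (inr i)))%SET.

Lemma lefts_nondesc i : lefts \subset nondesc i.
Proof.
apply/fintype.subsetP => -[j|j]; rewrite inE// => _.
rewrite finset.in_setC finset.in_setU1 /=; apply/negP => /causal_dsc_inr[l] //.
Qed.

Lemma stage_nondesc B (i : 'I_n) : stage B i \subset nondesc i.
Proof.
apply/fintype.subsetP => -[j|j] h.
  by apply: (fintype.subsetP (lefts_nondesc i)); rewrite inE.
move: h; rewrite inE => /andP[jB ji].
rewrite finset.in_setC finset.in_setU1 negb_or; apply/andP; split.
  by apply: contraTneq ji => -[->]; rewrite ltnn.
by apply/negP => /causal_dsc_inr[l [<-]] /ltnW; rewrite leqNgt ji.
Qed.

Lemma pa_nondesc (i : 'I_n) : pa (causal_graph e) (inr i) \subset nondesc i.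
Proof.
apply/fintype.subsetP => -[j|j] h.
  by apply: (fintype.subsetP (lefts_nondesc i)); rewrite inE.
have ji : (j < i)%N by apply: sorted_e; move: h; rewrite !inE.
apply: (fintype.subsetP (stage_nondesc [set: _]%SET i)); rewrite !inE/=; exact: ji.
Qed.

Lemma pa_stage (B : {set 'I_n}) (i : 'I_n) : i \in B -> pa e i \subset B ->
  pa (causal_graph e) (inr i) \subset stage B i.
Proof.
move=> iB /fintype.subsetP paB; apply/fintype.subsetP => -[j|j]; rewrite !inE /=.
  by case/orP => [ji|/eqP -> //]; apply: paB; rewrite inE.
move=> ji; have jp : j \in pa e i by rewrite inE.
by rewrite paB//=; exact: sorted_e.
Qed.

(** Transitivity of the graph enters here: it makes the vertices on which the k-th action may depend
    an admissible [B] for [causal_chain]. *)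
Lemma pa_closed_vertex (k j : 'I_n) : j \in (k |: pa e k)%SET ->
  pa e j \subset (k |: pa e k)%SET.
Proof.
move=> jB; apply/fintype.subsetP => l lj; apply/setU1P; right.
by case/setU1P: jB lj => [-> //|jk lj]; exact: closed_e jk.
Qed.

End causal_graphs.

Section causal_chain.
Variables (R : realType) (n : nat) (X Y : 'I_n -> ptopologicalType).
Hypotheses (polishX : forall i, polish R (X i)) (polishY : forall i, polish R (Y i)).
Variable e : rel 'I_n.
Hypotheses (sorted_e : sorted_graph e) (closed_e : transitively_closed e).

Local Notation PX := (prod_topology X).
Local Notation PY := (prod_topology Y).
Local Notation Omega := (borel (PX * PY)%type).

Variable P : probability Omega R.
Hypothesis compatP : graph_compatible (Omega := Omega) (@coord_sum 'I_n X Y) P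
  (causal_graph e).

Local Notation xi := (@coord_sum 'I_n X Y : forall a, Omega -> family_sum X Y a).
Local Notation gen := (coord_gen xi).

Lemma polish_family_sum a : polish R (family_sum X Y a).
Proof. by case: a => i; [exact: polishX|exact: polishY]. Qed.

Lemma borel_fst : measurable_fun setT (fst : Omega -> borel PX).
Proof.
apply: (@continuous_borel_measurable (PX * PY)%type PX); move=> z; exact: cvg_fst.
Qed.

Lemma borel_snd : measurable_fun setT (snd : Omega -> borel PY).
Proof.
apply: (@continuous_borel_measurable (PX * PY)%type PY); move=> z; exact: cvg_snd.
Qed.

Lemma borel_proj (Z : 'I_n -> ptopologicalType) i :
  measurable_fun setT ((fun z => z i) : borel (prod_topology Z) -> borel (Z i)).
Proof.
apply: (@continuous_borel_measurable (prod_topology Z) (Z i)).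
exact: (@proj_continuous _ Z i).
Qed.

Lemma borel_coord_sum a : measurable_fun setT (xi a : Omega -> borel (family_sum X Y a)).
Proof.
case: a => i.
  exact: (measurableT_comp (@borel_proj X i) borel_fst).
exact: (measurableT_comp (@borel_proj Y i) borel_snd).
Qed.

Lemma gen_measurable B : gen B `<=` measurable.
Proof. exact: coord_gen_sub_measurable borel_coord_sum. Qed.

Lemma gen_sigmaS (B C : {set 'I_n + 'I_n}) : B \subset C -> <<s gen B >> `<=` <<s gen C >>.
Proof.
move=> /(coord_genS (xi := xi)) BC; apply: sub_generated => A /BC.
exact: sub_sigma_algebra.
Qed.

(** In the application [q] is P(D | X_B), for an event D of X. Adjoining Y_i does not change it:
    given its parents, which belong to the current stage, Y_i is independent of its nondescendants,
    and these include both X and the current stage. *)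
Lemma causal_chain (B : {set 'I_n}) (D : set Omega) (q : Omega -> R) :
  (forall j, j \in B -> pa e j \subset B) ->
  <<s gen (lefts n) >> D ->
  measurable_fun setT (q : g_sigma_algebraType (gen (lefts n)) -> R) ->
  (forall z, 0 <= q z) ->
  (forall A, <<s gen (stage B 0) >> A -> P (A `&` D) = \int[P]_(z in A) (q z)%:E)%E ->
  forall m, (m <= n)%N ->
  (forall A, <<s gen (stage B m) >> A -> P (A `&` D) = \int[P]_(z in A) (q z)%:E)%E.
Proof.
move=> Bcl DL mq q0 H0; elim=> [//|m IH] mn.
have {}IH := IH (ltnW mn); pose i : 'I_n := Ordinal mn.
have [iB|iB] := boolP (i \in B); last first.
  rewrite (_ : stage B m.+1 = stage B m)//; apply/setP => -[j|j]; rewrite !inE//.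
  have [jB|//] := boolP (j \in B); rewrite /= ltnS leq_eqVlt.
  by case: eqP => // jm; move: iB; rewrite (_ : i = j) ?jB//; exact: val_inj.
move=> A HA.
(* The stage is joined with sigma(Y_i), inside the sigma-algebra of the nondescendants of i'. *)
have := @agree_join _ _ R P (gen (stage B m)) (sigma1 xi (inr i)) (gen (nondesc e i)) D q
  (@gen_measurable _) (@gen_measurable _).
have s1m v : sigma1 xi v `<=` (measurable : set (set Omega)).
  by move=> _ [C mC <-]; exact: borel_coord_sum.
move=> /(_ (s1m _) (gen_sigmaS (stage_nondesc sorted_e B i))).
have sI : setI_closed (sigma1 xi (inr i)).
  move=> _ _ [C mC <-] [C' mC' <-]; exists (C `&` C'); first exact: measurableI.
  by rewrite !setTI.
have sT : sigma1 xi (inr i) setT by exists setT => //; rewrite setTI.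
move=> /(_ sI sT (gen_sigmaS (lefts_nondesc sorted_e i) DL)).
move=> /(_ (sub_sigma_measurable_fun (gen_sigmaS (lefts_nondesc sorted_e i)) mq) q0 IH).
apply; last first.
  apply: sub_generated HA => C [v /= vS vC]; apply: sub_sigma_algebra.
  move: vS; rewrite inE.
  have [vm _|+ +] := boolP (v \in stage B m); first by left; exists v.
  move=> vm vS; right; case: v vC vm vS => j vC /negP; rewrite inE => vm.
    by move=> jB; case: vm.
  rewrite ltnS leq_eqVlt => /andP[jB].
  case: eqP => [jm _|_ /= jm]; last by case: vm; rewrite jB.
  by have -> : i = j by exact: val_inj.
move=> A2 FA2.
have subN : sigma_sub xi (nondesc e i) = <<s gen (nondesc e i) >>.
  exact: (sigma_subE polish_family_sum).
have subP : sigma_sub xi (pa (causal_graph e) (inr i)) = <<s gen (pa (causal_graph e) (inr i)) >>.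
  exact: (sigma_subE polish_family_sum).
have PN : sigma_sub xi (pa (causal_graph e) (inr i)) `<=` sigma_sub xi (nondesc e i).
  by rewrite subP subN; exact: gen_sigmaS (pa_nondesc sorted_e i).
have Nm : sigma_sub xi (nondesc e i) `<=` (measurable : set (set Omega)).
  by rewrite subN; exact: smallest_sub (@sigma_algebra_measurable _ Omega) (@gen_measurable _).
have [g [mg g0 gE]] := cond_indep_integral (@compatP (inr i))
  (@sigma_sub_sigma_algebra _ _ _ _ xi _) PN Nm (s1m _) FA2.
exists g; split => //.
  apply: sub_sigma_measurable_fun mg.
  apply: sub_generated; rewrite subP; apply: gen_sigmaS; exact: (pa_stage sorted_e iB (Bcl _ iB)).
by move=> E; rewrite -subN; exact: gE.
Qed.


Section vertex_sigma_algebras.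
Variables (Z : 'I_n -> ptopologicalType) (k : 'I_n).
Hypothesis polishZ : forall i, polish R (Z i).

Let zeta := fun v (x : borel (prod_topology Z)) => (x : prod_topology Z) v.

(** Generators of [sigma_vertex_pa], kept separate so that they can index a measurable structure. *)
Definition vertex_gen : set (set (borel (prod_topology Z))) :=
  sigma1 zeta k `|` sigma_sub zeta (pa e k).

Lemma vertex_gen_measurable : vertex_gen `<=` measurable.
Proof.
move=> A [[B mB <-]|].
  exact: borel_proj.
rewrite (sigma_subE polishZ) => h; move: A h.
apply: (smallest_sub (@sigma_algebra_measurable _ (borel (prod_topology Z)))).
by apply: coord_gen_sub_measurable; exact: borel_proj.
Qed.

Lemma vertex_gen_comp (G : set (set Omega)) (phi : Omega -> borel (prod_topology Z)) :
  (forall j, j \in (k |: pa e k)%SET ->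
    measurable_fun setT ((fun z => (phi z : prod_topology Z) j) :
      g_sigma_algebraType G -> borel (Z j))) ->
  measurable_fun setT (phi : g_sigma_algebraType G -> g_sigma_algebraType vertex_gen).
Proof.
move=> mphi; apply: measurability; first exact: (erefl <<s vertex_gen >>).
move=> _ [A hA <-]; rewrite setTI; case: hA => [[B mB <-]|[B mB <-]].
  rewrite setTI -[X in measurable X]setTI.
  by apply: mphi => //; rewrite setU11.
rewrite setTI.
have : measurable_fun setT
    ((@subvector _ Z _ Omega (fun v z => (phi z : prod_topology Z) v) (pa e k)) :
      g_sigma_algebraType G -> borel (subproduct Z (pa e k))).
  apply: (@prod_borel_generated R _ (fun v : {v : 'I_n | v \in pa e k} => Z (sval v)) _ _
      (fun v z => (phi z : prod_topology Z) (sval v))).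
    by move=> i; exact: polishZ.
  by move=> [v vB]; apply: mphi; rewrite setU1r.
by move=> /(_ measurableT _ mB); rewrite setTI.
Qed.

End vertex_sigma_algebras.

(* Given X_k and X_pa(k), the pair (Y_k, Y_pa(k)) is independent of X. *)
Lemma causal_conditional (k : 'I_n) (A' : set (borel PY)) (p : borel PX -> R) :
  <<s vertex_gen (Z := Y) k >> A' ->
  measurable_fun setT (p : g_sigma_algebraType (vertex_gen (Z := X) k) -> R) ->
  (forall x, 0 <= p x) ->
  (forall D : set (borel PX), <<s vertex_gen (Z := X) k >> D ->
    P (snd @^-1` A' `&` fst @^-1` D) = \int[P]_(z in fst @^-1` D) (p z.1)%:E)%E ->
  forall D : set (borel PX), measurable D ->
    (P (snd @^-1` A' `&` fst @^-1` D) = \int[P]_(z in fst @^-1` D) (p z.1)%:E)%E.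
Proof.
move=> kA' mp p0 pE D mD.
pose B := (k |: pa e k)%SET.
have Xm := vertex_gen_measurable polishX (k := k).
have Ym := vertex_gen_measurable polishY (k := k).
have mA' : measurable A' by apply: (smallest_sub (@sigma_algebra_measurable _ (borel PY)) Ym).
have mA : measurable (snd @^-1` A' : set Omega).
  by rewrite -[X in measurable X]setTI; exact: borel_snd.
have mDf : measurable (fst @^-1` D : set Omega).
  by rewrite -[X in measurable X]setTI; exact: borel_fst.
have mfst : measurable_fun setT (fst : Omega -> g_sigma_algebraType (vertex_gen (Z := X) k)).
  move=> _ C kC; apply: borel_fst => //.
  exact: (smallest_sub (@sigma_algebra_measurable _ (borel PX)) Xm).
pose fx := isMeasurableFun.Build _ _ _ _ _ mfst.
pose phi : {mfun Omega >-> g_sigma_algebraType (vertex_gen (Z := X) k)} :=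
  HB.pack (fst : Omega -> g_sigma_algebraType (vertex_gen (Z := X) k)) fx.
(* The chain concerns events of X, so the roles are exchanged: [q] is P(X in D | X_k, X_pa(k)),
   whereas [p] is the conditional probability of the event A' of Y. *)
have [q [mq q0 qE]] := conditional_probability_exists P phi mDf.
have mqT : measurable_fun setT (fun z : Omega => q z.1) := measurableT_comp mq mfst.
have mpT : measurable_fun setT (fun z : Omega => p z.1) := measurableT_comp mp mfst.
have i0 (C : set Omega) z : 0 <= \1_C z :> R by rewrite indicE.
have genX j (C : {set 'I_n + 'I_n}) : inl j \in C -> measurable_fun setT
    ((fun z => z.1 j) : g_sigma_algebraType (gen C) -> borel (X j)).
  by move=> jC; exact: (coord_gen_measurable (xi := xi) jC).
have genY j (C : {set 'I_n + 'I_n}) : inr j \in C -> measurable_fun setT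
    ((fun z => z.2 j) : g_sigma_algebraType (gen C) -> borel (Y j)).
  by move=> jC; exact: (coord_gen_measurable (xi := xi) jC).
have mfstl : measurable_fun setT (fst : g_sigma_algebraType (gen (lefts n)) -> borel PX).
  apply: (@prod_borel_generated R _ X _ _ (fun j (z : PX * PY) => z.1 j)) => // j.
  by apply: genX; rewrite inE.
have mqX : measurable_fun setT (q : borel PX -> R) by exact: sub_measurable_fun mq.
have AE : (P (snd @^-1` A' `&` fst @^-1` D) = \int[P]_(z in snd @^-1` A') (q z.1)%:E)%E.
  apply: (@causal_chain B (fst @^-1` D) (fun z => q z.1) _ _ _ _ _ n) => //.
  - exact: pa_closed_vertex.
  - by have := mfstl measurableT D mD; rewrite setTI.
  - exact: (measurableT_comp mqX mfstl).
  - move=> C HC.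
    have [C' kC' <-] : preimage_set_system setT (fst : Omega -> PX) <<s vertex_gen (Z := X) k >> C.
      apply: smallest_sub HC.
        exact/sigma_algebra_preimage/smallest_sigma_algebra.
      move=> E [[v|v] /= vS [F mF <-]]; last by move: vS; rewrite inE andbF.
      exists ((fun x : PX => x v) @^-1` F); last by rewrite !setTI.
      move: vS; rewrite inE => /setU1P[vk|vk].
        by apply: sub_sigma_algebra; left; rewrite vk in F mF *; exists F => //; rewrite setTI.
      apply: sub_sigma_algebra; right; rewrite (sigma_subE polishX).
      by apply: sub_sigma_algebra; exists v => //; exists F => //; rewrite setTI.
    by rewrite setTI setIC; exact: qE.
  - have := @vertex_gen_comp Y k polishY (gen (stage B n)) snd _ measurableT A' kA'.
    rewrite setTI; apply => j jB; apply: genY.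
    by rewrite inE ltn_ord andbT.
(* With E[1_A' q] at hand, both indicators are exchanged for densities: E[q 1_A'] = E[q p] =
   E[p 1_D]. *)
rewrite AE -integral_indicM// -[RHS]integral_indicM//.
transitivity (\int[P]_z (q (phi z) * p (phi z))%:E)%E.
  transitivity (\int[P]_z (q (phi z) * \1_(snd @^-1` A') z)%:E)%E.
    by apply: eq_integral => z _; rewrite mulrC.
  refine (integralM_eq mfst (i0 _) (fun z => p0 z.1) q0 _ mpT mq _).
    exact: measurable_indic.
  move=> C kC; rewrite -probI_integral//; first by rewrite setIC; exact: pE.
  by rewrite -[X in measurable X]setTI; exact: (mfst measurableT).
transitivity (\int[P]_z (p (phi z) * q (phi z))%:E)%E.
  by apply: eq_integral => z _; rewrite mulrC.
transitivity (\int[P]_z (p (phi z) * \1_(fst @^-1` D) z)%:E)%E; last first.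
  by apply: eq_integral => z _; rewrite mulrC.
refine (integralM_eq mfst (fun z => q0 z.1) (i0 _) p0 mqT _ mp _).
  exact: measurable_indic.
move=> C kC; rewrite -probI_integral//; first by rewrite setIC; exact/esym/qE.
by rewrite -[X in measurable X]setTI; exact: (mfst measurableT).
Qed.

End causal_chain.

(** * Convex functions on boxes *)

Section jensen.
Variables (R : realType) (E : lmodType R) (A : set E).

Lemma convex_set2 : convex_set A -> forall (t : R) x y, 0 <= t -> t <= 1 ->
  A x -> A y -> A (t *: x + (1 - t) *: y).
Proof.
move=> cA t x y t0 t1 /mem_set Ax /mem_set Ay.
by have /set_mem := cA x y (Itv01 t0 t1) Ax Ay.
Qed.

Lemma convex_function2 (f : E -> R) : convex_function A f ->
  forall (t : R) x y, 0 <= t -> t <= 1 -> A x -> A y ->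
  f (t *: x + (1 - t) *: y) <= t * f x + (1 - t) * f y.
Proof.
move=> cf t x y t0 t1 /mem_set Ax /mem_set Ay.
by have := cf (Itv01 t0 t1) x y Ax Ay.
Qed.

(** Tails of a list of weights do not sum to 1, hence the normalisation by the total weight.
    Membership in [A] is proved jointly, since convexity of [f] is only available there and the
    induction applies it to the barycentre of the tail. *)
Lemma jensen_seq (f : E -> R) (I : eqType) (s : seq I) (w : I -> R) (a : I -> E) :
  convex_set A -> convex_function A f ->
  (forall i, 0 <= w i) -> (forall i, A (a i)) -> 0 < \sum_(i <- s) w i ->
  let W := \sum_(i <- s) w i in
  A (W^-1 *: \sum_(i <- s) w i *: a i) /\
  f (W^-1 *: \sum_(i <- s) w i *: a i) <= W^-1 * \sum_(i <- s) w i * f (a i).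
Proof.
move=> /convex_set2 cA /convex_function2 cf w0 Aa.
elim: s => [|i s IH]; first by rewrite big_nil ltxx.
rewrite !big_cons => W0 W; have [W's|W's] := ltP 0 (\sum_(j <- s) w j); last first.
  have s0 : forall j, j \in s -> w j = 0.
    have /eqP : \sum_(j <- s) w j = 0 by apply/eqP; rewrite eq_le W's sumr_ge0.
    by rewrite psumr_eq0// => /allP h j /h /eqP.
  have E0 : \sum_(j <- s) w j *: a j = 0.
    by rewrite big_seq big1// => j /s0 ->; rewrite scale0r.
  have F0 : \sum_(j <- s) w j * f (a j) = 0.
    by rewrite big_seq big1// => j /s0 ->; rewrite mul0r.
  have WE : W = w i by rewrite /W [X in _ + X]big_seq big1 ?addr0// => j /s0.
  have wi0 : w i != 0 by rewrite -WE gt_eqF.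
  by rewrite E0 F0 !addr0 WE scalerA mulrA mulVf// scale1r mul1r.
have [As fs] := IH W's.
set V := \sum_(j <- s) w j in W W0 W's As fs *.
set e := \sum_(j <- s) w j *: a j in As fs *.
have t0 : 0 <= w i / W by rewrite divr_ge0// ltW.
have t1 : w i / W <= 1 by rewrite ler_pdivrMr// mul1r lerDl ltW.
have tE : 1 - w i / W = V / W by rewrite /W; field; rewrite gt_eqF.
have eE : W^-1 *: (w i *: a i + e) = (w i / W) *: a i + (1 - w i / W) *: (V^-1 *: e).
  rewrite tE scalerDr !scalerA; congr (_ *: _ + _ *: _); first by rewrite mulrC.
  by field; rewrite !gt_eqF.
rewrite eE; split; first exact: cA.
apply: (le_trans (cf _ _ _ t0 t1 (Aa i) As)).
apply: (@le_trans _ _ (w i / W * f (a i) + (1 - w i / W) * (V^-1 * \sum_(j <- s) w j * f (a j)))).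
  by rewrite lerD2l ler_wpM2l// subr_ge0.
set F := \sum_(j <- s) w j * f (a j); rewrite tE.
have V0 : V != 0 by rewrite gt_eqF.
have WN0 : W != 0 by rewrite gt_eqF.
by rewrite le_eqVlt; apply/orP; left; apply/eqP; field; rewrite WN0 V0.
Qed.

Lemma jensen (f : E -> R) (I : finType) (w : I -> R) (a : I -> E) :
  convex_set A -> convex_function A f ->
  (forall i, 0 <= w i) -> (forall i, A (a i)) -> \sum_i w i = 1 ->
  A (\sum_i w i *: a i) /\ f (\sum_i w i *: a i) <= \sum_i w i * f (a i).
Proof.
move=> cA cf w0 Aa w1.
have := @jensen_seq f I (index_enum I) w a cA cf w0 Aa.
by rewrite /= w1 invr1 scale1r mul1r; apply.
Qed.

End jensen.

Section boxes.
Variables (R : realType) (n : nat) (Ak : 'I_n -> set R).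

(** Changing one coordinate of a fixed point of the product, within its factor, stays in the
    product. So each factor is a coordinate image of a compact set, which attains its extrema, and
    convexity fills the interval between them. *)
Lemma box_bounds : product_set Ak !=set0 -> compact (product_set Ak) ->
  convex_set (product_set Ak) ->
  exists l u : 'I_n -> R, forall k, l k <= u k /\
    forall t, Ak k t <-> l k <= t <= u k.
Proof.
move=> [a0 Aa0] cA /convex_set2 vA.
have ck k : {within product_set Ak, continuous (fun a : 'rV[R]_n => a ord0 k)}.
  by apply: continuous_subspaceT; exact: coord_continuous.
pose put k t : 'rV[R]_n := \row_j (if j == k then t else a0 ord0 j).
have putk k t : put k t ord0 k = t by rewrite mxE eqxx.
have Aput k t : Ak k t -> product_set Ak (put k t).
  by move=> Akt j; rewrite mxE; case: eqP => [->|_].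
have A0 : product_set Ak !=set0 by exists a0.
have mx k : exists t, Ak k t /\ forall s, Ak k s -> s <= t.
  have [c /set_mem Ac cmax] := compact_EVT_max A0 cA (@ck k).
  exists (c ord0 k); split=> [|s /Aput Aks]; first exact: Ac.
  by rewrite -(putk k s); apply: cmax; exact/mem_set.
have mn k : exists t, Ak k t /\ forall s, Ak k s -> t <= s.
  have [c /set_mem Ac cmin] := compact_EVT_min A0 cA (@ck k).
  exists (c ord0 k); split=> [|s /Aput Aks]; first exact: Ac.
  by rewrite -(putk k s); apply: cmin; exact/mem_set.
have [u uP] := choice mx; have [l lP] := choice mn.
exists l, u => k; have [Au umax] := uP k; have [Al lmin] := lP k.
have lu : l k <= u k by exact: umax.
split=> // t; split=> [At|/andP[lt tu]]; first by rewrite lmin//= umax.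
have [ul|ul] := eqVneq (u k) (l k).
  suff -> : t = l k by [].
  by apply/eqP; rewrite eq_le lt -ul tu.
have d0 : 0 < u k - l k by rewrite subr_gt0 lt_neqAle eq_sym ul.
pose s := (t - l k) / (u k - l k).
have s0 : 0 <= s by rewrite divr_ge0 ?subr_ge0// ltW.
have s1 : s <= 1 by rewrite ler_pdivrMr// mul1r lerD2r.
have := vA s _ _ s0 s1 (Aput _ _ Au) (Aput _ _ Al) k; rewrite !mxE eqxx.
congr (Ak k _); rewrite /s; field; exact: lt0r_neq0.
Qed.

Variables l u : 'I_n -> R.
Hypothesis lu : forall k, l k <= u k.
Hypothesis AkE : forall k t, Ak k t <-> l k <= t <= u k.

Definition rel_pos (k : 'I_n) (t : R) : R := (t - l k) / (u k - l k).

(* Holds also when [l k = u k], where [rel_pos] is a division by 0. *)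
Lemma rel_posK k t : Ak k t -> t = l k + (u k - l k) * rel_pos k t.
Proof.
move=> /AkE /andP[lt tu]; have [ul|ul] := eqVneq (u k) (l k).
  by rewrite ul subrr mul0r addr0; apply/eqP; rewrite eq_le lt -ul tu.
by rewrite /rel_pos; field; rewrite subr_eq0.
Qed.

Lemma rel_pos01 k t : Ak k t -> 0 <= rel_pos k t <= 1.
Proof.
move=> /AkE /andP[lt tu]; apply/andP; split.
  by rewrite divr_ge0// subr_ge0.
have [ul|ul] := eqVneq (u k) (l k); first by rewrite /rel_pos ul subrr invr0 mulr0.
by rewrite ler_pdivrMr ?mul1r ?lerD2r// subr_gt0 lt_neqAle eq_sym ul lu.
Qed.

Lemma Ak_rel k s : 0 <= s <= 1 -> Ak k (l k + (u k - l k) * s).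
Proof.
move=> /andP[s0 s1]; apply/AkE; have := lu k; rewrite -subr_ge0 => d0.
by apply/andP; split; nra.
Qed.

Definition vertex (f : {ffun 'I_n -> bool}) : 'rV[R]_n :=
  \row_k (if f k then u k else l k).

Lemma vertex_in f : product_set Ak (vertex f).
Proof.
move=> k; rewrite mxE; apply/AkE; have := lu k.
by case: (f k) => h; rewrite lexx h.
Qed.

(** Choosing each coordinate independently at an end of its interval, with mean [a], writes [a] as a
    convex combination of the vertices; Jensen's inequality applies and the weights are at most 1.
    The bound no longer depends on [a], so it controls the rounding error of any action. *)
Lemma convex_le_vertices (q : 'rV[R]_n -> R) a :
  convex_set (product_set Ak) -> convex_function (product_set Ak) q ->
  (forall a, product_set Ak a -> 0 <= q a) ->
  product_set Ak a -> q a <= \sum_f q (vertex f).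
Proof.
move=> cA cq q0 Aa.
pose s k := rel_pos k (a ord0 k).
pose F k (b : bool) := if b then s k else 1 - s k.
pose w (f : {ffun 'I_n -> bool}) := \prod_k F k (f k).
have F01 k b : 0 <= F k b <= 1.
  by have /andP[s0 s1] := rel_pos01 (Aa k); rewrite /F /s; case: b; apply/andP; split; lra.
have w0 f : 0 <= w f by apply: prodr_ge0 => k _; have /andP[] := F01 k (f k).
have w1 f : w f <= 1.
  by apply: prodr_ile1 => k _; exact: F01.
have FS k : \sum_b F k b = 1 by rewrite big_bool /F /=; lra.
have wS : \sum_f w f = 1.
  by rewrite -(bigA_distr_bigA F) big1.
have aE : a = \sum_f w f *: vertex f.
  apply/rowP => k; rewrite summxE.
  (* The k-th coordinate of the vertex is put into the k-th factor, so that distributivity turns the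
     weighted sum over vertices into a product of sums over single coordinates. *)
  pose G j b := F j b * (if j == k then (if b then u k else l k) else 1).
  transitivity (\prod_j \sum_b G j b).
    rewrite (bigD1 k)//= [X in _ * X]big1 => [|j jk].
      rewrite mulr1 big_bool /G /F/= eqxx {1}(rel_posK (Aa k)) /s; lra.
    rewrite -[RHS](FS j); apply: eq_bigr => b _.
    by rewrite /G (negbTE jk) mulr1.
  rewrite bigA_distr_bigA; apply: eq_bigr => f _.
  rewrite !mxE /G big_split/=; congr (_ * _).
  by rewrite (bigD1 k)//= eqxx big1 ?mulr1// => j /negbTE ->.
rewrite {1}aE; apply: (le_trans (jensen cA cq w0 vertex_in wS).2).
by apply: ler_sum => f _; rewrite ler_piMl// q0//; exact: vertex_in.
Qed.

Variable m : nat.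

Definition grid_point k (j : nat) : R := l k + (u k - l k) * (j%:R / m.+1%:R).

Definition grid (f : {ffun 'I_n -> 'I_m.+2}) : 'rV[R]_n := \row_k grid_point k (f k).

(** For s in [0, 1] put r = floor(m s) + 1 - m s, which is again in [0, 1]. Then (floor(m s) + 1) /
    (m + 1) is the combination of s with weight m / (m + 1) and r with weight 1 / (m + 1). The index
    is at most m + 1 on the box. *)
Definition grid_index k (t : R) : 'I_m.+2 :=
  inord (Num.truncn (m%:R * rel_pos k t)).+1.

Definition grid_round (a : 'rV[R]_n) : {ffun 'I_n -> 'I_m.+2} :=
  [ffun k => grid_index k (a ord0 k)].

Lemma grid_point_in k (j : 'I_m.+2) : Ak k (grid_point k j).
Proof.
apply: Ak_rel; rewrite divr_ge0//= ler_pdivrMr// mul1r ler_nat.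
by rewrite -ltnS.
Qed.

Lemma grid_in f : product_set Ak (grid f).
Proof. by move=> k; rewrite mxE; exact: grid_point_in. Qed.

(* The rounded action is a convex combination, with weight 1 / (m + 1) on some
   point of the box; this is how rounding can avoid any continuity of the convex
   function, which may jump at the boundary. *)
Lemma grid_round_le (q : 'rV[R]_n -> R) a :
  convex_set (product_set Ak) -> convex_function (product_set Ak) q ->
  (forall a, product_set Ak a -> 0 <= q a) -> product_set Ak a ->
  q (grid (grid_round a)) <= q a + m.+1%:R^-1 * \sum_f q (vertex f).
Proof.
move=> cA cq q0 Aa.
pose s k := rel_pos k (a ord0 k).
pose j k := (Num.truncn (m%:R * s k)).+1.
have M0 : 0 < m.+1%:R :> R by [].
have s01 k : 0 <= s k <= 1 by exact: rel_pos01.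
have jm k : (j k < m.+2)%N.
  rewrite /j !ltnS; have /andP[s0 s1] := s01 k.
  have h : m%:R * s k <= m%:R by rewrite ler_piMr.
  by have := le_truncn h; rewrite natrK.
have js k : 0 <= (j k)%:R - m%:R * s k <= 1.
  have /andP[s0 _] := s01 k.
  have ms0 : 0 <= m%:R * s k by rewrite mulr_ge0.
  have /andP[h1 h2] := truncn_itv ms0.
  by rewrite subr_ge0 lerBlDr /j (ltW h2)/= -natr1 addrC lerD2l.
pose b : 'rV[R]_n := \row_k (l k + (u k - l k) * ((j k)%:R - m%:R * s k)).
have Ab : product_set Ak b by move=> k; rewrite mxE; exact: Ak_rel.
have gE : grid (grid_round a) = m.+1%:R^-1 *: b + (1 - m.+1%:R^-1) *: a.
  apply/rowP => k; rewrite !mxE ffunE /grid_index inordK ?jm//.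
  rewrite {2}(rel_posK (Aa k)) /grid_point -/(s k) -/(j k) -[m.+1%:R]natr1.
  by field; rewrite natr1 gt_eqF.
have t0 : 0 <= m.+1%:R^-1 :> R by rewrite invr_ge0 ltW.
have t1 : m.+1%:R^-1 <= 1 :> R by rewrite invf_le1// ler1n.
rewrite gE; apply: (le_trans (convex_function2 cq t0 t1 Ab Aa)).
have h1 : m.+1%:R^-1 * q b <= m.+1%:R^-1 * \sum_f q (vertex f).
  by rewrite ler_wpM2l//; exact: convex_le_vertices.
have h2 : (1 - m.+1%:R^-1) * q a <= q a.
  by rewrite ler_piMl ?q0// lerBlDr lerDl.
by rewrite addrC; exact: lerD.
Qed.

(** Real numbers [t] outside the box are included; there [inord] may fall back to 0, so a level set
    is a union over all the integer parts sent to [c]. *)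
Lemma grid_index_measurable k (c : 'I_m.+2) :
  measurable [set t : R | grid_index k t = c].
Proof.
have mg : measurable_fun setT (fun t : R => m%:R * rel_pos k t).
  by apply: measurable_funM => //; apply: measurable_funM => //; exact: measurable_funB.
have mlt i : measurable [set t : R | (i < Num.truncn (m%:R * rel_pos k t)%R)%N].
  rewrite (_ : mkset _ = (fun t => m%:R * rel_pos k t) @^-1` `[i.+1%:R, +oo[).
    by rewrite -[X in measurable X]setTI; exact: mg.
  by apply/seteqP; split => t; rewrite /= in_itv/= andbT truncn_gt_nat.
have mge i : measurable [set t : R | (i <= Num.truncn (m%:R * rel_pos k t)%R)%N].
  case: i => [|i]; last exact: mlt.
  by rewrite (_ : mkset _ = setT)//; apply/seteqP; split.
rewrite (_ : mkset _ = \bigcup_(i in [set i : nat | inord i.+1 = c])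
   ([set t : R | (i <= Num.truncn (m%:R * rel_pos k t)%R)%N] `\`
    [set t : R | (i < Num.truncn (m%:R * rel_pos k t)%R)%N])).
  by apply: bigcup_measurable => i _; exact: measurableD.
apply/seteqP; split => t /=.
  by exists (Num.truncn (m%:R * rel_pos k t)) => //=; rewrite leqnn ltnn.
move=> [i /= ic [it /negP]]; rewrite -leqNgt => ti; rewrite -ic /grid_index.
by congr (inord _.+1); apply/eqP; rewrite eqn_leq ti.
Qed.

End boxes.

(** * Actions and costs under causal couplings *)

Lemma integral_image_measure d d' (T : measurableType d) (T' : measurableType d')
    (R : realType) (P : {measure set T -> \bar R}) (mu : {measure set T' -> \bar R})
    (phi : T -> T') (D : set T') (f : T' -> \bar R) :
  measurable_fun setT phi -> (forall B, measurable B -> P (phi @^-1` B) = mu B) ->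
  measurable D -> measurable_fun setT f -> (forall x, 0 <= f x)%E ->
  (\int[mu]_(x in D) f x = \int[P]_(z in phi @^-1` D) f (phi z))%E.
Proof.
move=> mphi phiE mD mf f0.
rewrite -(ge0_integral_pushforward mphi P mD) //; last exact: measurable_funTS.
by apply: eq_measure_integral => B mB _; rewrite -phiE.
Qed.

Section metric.
Variables (R : realType) (T : ptopologicalType) (d : T -> T -> R).
Hypotheses (md : is_metric d) (td : induces_topology d).

Lemma metric_ge0 x y : 0 <= d x y.
Proof.
have [d0 dC dT] := md; have := dT x y x; rewrite (d0 x x).2// (dC y x).
by rewrite -mulr2n pmulrn_lge0.
Qed.

Lemma lipschitz_continuous (f : T -> R) (L : R) : 0 < L ->
  (forall x y, `|f x - f y| <= L * d x y) -> continuous f.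
Proof.
move=> L0 fL x; apply/cvgrPdist_lt => eps eps0.
have /td : exists2 r, 0 < r & [set y | d x y < r] `<=` [set y | `|f x - f y| < eps].
  exists (eps / L); first exact: divr_gt0.
  by move=> y /=; rewrite ltr_pdivlMr// mulrC; exact: le_lt_trans.
exact.
Qed.

Lemma metric_continuous : continuous (fun z : T * T => d z.1 z.2).
Proof.
have [d0 dC dT] := md.
move=> z; apply/cvgrPdist_lt => eps eps0.
have e2 : 0 < eps / 2 by rewrite divr_gt0.
have h1 : \forall y \near nbhs z, d z.1 y.1 < eps / 2.
  have : nbhs z.1 [set y | d z.1 y < eps / 2] by apply/td; exists (eps / 2).
  exact: cvg_fst.
have h2 : \forall y \near nbhs z, d z.2 y.2 < eps / 2.
  have : nbhs z.2 [set y | d z.2 y < eps / 2] by apply/td; exists (eps / 2).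
  exact: cvg_snd.
apply: filterS2 h1 h2 => y h1 h2.
have := dT z.1 y.1 z.2; have := dT y.1 y.2 z.2; have := dT y.1 z.1 y.2.
have := dT z.1 z.2 y.2; rewrite (dC y.2 z.2) (dC y.1 z.1) ltr_norml => *.
by apply/andP; split; lra.
Qed.

End metric.

Section causal_couplings.
Variables (R : realType) (n : nat) (X : 'I_n -> ptopologicalType).
Hypothesis polishX : forall i, polish R (X i).
Variable e : rel 'I_n.
Hypotheses (sorted_e : sorted_graph e) (closed_e : transitively_closed e).

Local Notation PX := (prod_topology X).
Local Notation Omega := (borel (PX * PX)%type).
Local Notation vgen k := (vertex_gen e (Z := X) k).

Variables (mu nu : probability (borel PX) R) (P : probability Omega R).
Hypothesis causalP : causal_coupling e mu nu P.

Let mfst : measurable_fun setT (fst : Omega -> borel PX) := @borel_fst n X X.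
Let msnd : measurable_fun setT (snd : Omega -> borel PX) := @borel_snd n X X.

Lemma integral_fst D (f : borel PX -> \bar R) : measurable D ->
  measurable_fun setT f -> (forall x, 0 <= f x)%E ->
  (\int[mu]_(x in D) f x = \int[P]_(z in fst @^-1` D) f z.1)%E.
Proof.
move=> mD mf f0; have [[h _] _] := causalP.
refine (integral_image_measure mfst h mD mf f0).
Qed.

Lemma integral_snd D (f : borel PX -> \bar R) : measurable D ->
  measurable_fun setT f -> (forall x, 0 <= f x)%E ->
  (\int[nu]_(x in D) f x = \int[P]_(z in snd @^-1` D) f z.2)%E.
Proof.
move=> mD mf f0; have [[_ h] _] := causalP.
refine (integral_image_measure msnd h mD mf f0).
Qed.

Let vm k : vgen k `<=` measurable := vertex_gen_measurable polishX (k := k).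

Let vm' k : <<s vgen k >> `<=` measurable.
Proof. exact: (smallest_sub (@sigma_algebra_measurable _ (borel PX)) (@vm k)). Qed.

(** A conditional probability given (X_k, X_pa(k)) is, by causality, also one given X: [p] is
    measurable for the small sigma-algebra although [D] is any Borel set. *)
Lemma vertex_conditional (k : 'I_n) (A : set (borel PX)) : <<s vgen k >> A ->
  exists p : borel PX -> R,
    [/\ measurable_fun setT (p : g_sigma_algebraType (vgen k) -> R),
        forall x, 0 <= p x &
        forall D : set (borel PX), measurable D ->
          (P (snd @^-1` A `&` fst @^-1` D) = \int[mu]_(x in D) (p x)%:E)%E].
Proof.
move=> kA.
have mfstk : measurable_fun setT (fst : Omega -> g_sigma_algebraType (vgen k)).
  by move=> _ C kC; apply: mfst => //; exact: (@vm' k C kC).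
pose fx := isMeasurableFun.Build _ _ _ _ _ mfstk.
pose phi : {mfun Omega >-> g_sigma_algebraType (vgen k)} :=
  HB.pack (fst : Omega -> g_sigma_algebraType (vgen k)) fx.
have mA : measurable (snd @^-1` A : set Omega).
  by rewrite -[X in measurable X]setTI; apply: msnd => //; apply: vm'; exact: kA.
have [p [mp p0 pE]] := conditional_probability_exists P phi mA.
exists p; split => // D mD; rewrite integral_fst//.
  exact: (causal_conditional polishX polishX sorted_e closed_e causalP.2 kA mp p0 pE).
by apply/measurable_EFinP; exact: sub_measurable_fun mp.
Qed.

(** For events involving all coordinates of the action together; the resulting densities are the
    weights in Jensen's inequality. *)
Lemma joint_conditional (A : set (borel PX)) : measurable A ->
  exists p : borel PX -> R,
    [/\ measurable_fun setT p, forall x, 0 <= p x &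
        forall D : set (borel PX), measurable D ->
          (P (snd @^-1` A `&` fst @^-1` D) = \int[mu]_(x in D) (p x)%:E)%E].
Proof.
move=> mA'.
pose fx := isMeasurableFun.Build _ _ _ _ _ mfst.
pose phi : {mfun Omega >-> borel PX} := HB.pack (fst : Omega -> borel PX) fx.
have mA : measurable (snd @^-1` A : set Omega).
  by rewrite -[X in measurable X]setTI; exact: msnd.
have [p [mp p0 pE]] := conditional_probability_exists P phi mA.
exists p; split => // D mD; rewrite integral_fst//; first exact: pE.
exact/measurable_EFinP.
Qed.

Lemma density_unique (p r : borel PX -> R) (A : set Omega) :
  measurable_fun setT p -> measurable_fun setT r ->
  (forall x, 0 <= p x) -> measurable A ->
  (forall D : set (borel PX), measurable D ->
    P (A `&` fst @^-1` D) = \int[mu]_(x in D) (p x)%:E)%E ->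
  (forall D : set (borel PX), measurable D ->
    P (A `&` fst @^-1` D) = \int[mu]_(x in D) (r x)%:E)%E ->
  {ae mu, forall x, p x = r x}.
Proof.
move=> mp mr p0 mA pE rE.
have mid : measurable_fun setT (idfun : borel PX -> borel PX) by exact: measurable_id.
pose fx := isMeasurableFun.Build _ _ _ _ _ mid.
pose phi : {mfun borel PX >-> borel PX} := HB.pack (idfun : borel PX -> borel PX) fx.
apply: (ae_eq_of_integral (phi := phi) mp mr); last first.
  by move=> D mD; rewrite preimage_id -pE// -rE.
apply: (ge0_le1_integrable mp p0); rewrite -pE// preimage_setT setIT; exact: probability_le1.
Qed.

End causal_couplings.

(** * Averaging a rounded action into an adapted one *)

Section feedback.
Variables (R : realType) (n : nat) (X : 'I_n -> ptopologicalType).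
Hypothesis polishX : forall i, polish R (X i).
Variable e : rel 'I_n.
Hypotheses (sorted_e : sorted_graph e) (closed_e : transitively_closed e).

Local Notation PX := (prod_topology X).
Local Notation Omega := (borel (PX * PX)%type).
Local Notation vgen k := (vertex_gen e (Z := X) k).

Variables (mu nu : probability (borel PX) R) (P : probability Omega R).
Hypothesis causalP : causal_coupling e mu nu P.

Let mfst : measurable_fun setT (fst : Omega -> borel PX) := @borel_fst n X X.
Let msnd : measurable_fun setT (snd : Omega -> borel PX) := @borel_snd n X X.

Variables (Ak : 'I_n -> set R) (l u : 'I_n -> R).
Hypothesis lu : forall k, l k <= u k.
Hypothesis AkE : forall k t, Ak k t <-> l k <= t <= u k.
Hypothesis A_convex : convex_set (product_set Ak).

Variable Q : PX -> 'rV[R]_n -> R.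
Hypothesis Q_ge0 : forall x a, product_set Ak a -> 0 <= Q x a.
Hypothesis Q_convex : forall x, convex_function (product_set Ak) (Q x).
Hypothesis Q_meas : forall a, product_set Ak a ->
  measurable_fun setT (Q^~ a : borel PX -> R).

Variable m : nat.
Local Notation I := {ffun 'I_n -> 'I_m.+2}.
Local Notation pt := (grid (m := m) l u).

Variable J : borel PX -> I.
Hypothesis J_adapted : forall k c, <<s vgen k >> [set y | J y k = c].

Let vm k : <<s vgen k >> `<=` measurable.
Proof.
apply: (smallest_sub (@sigma_algebra_measurable _ (borel PX))).
exact: vertex_gen_measurable.
Qed.

Lemma level_measurable (S : pred I) : measurable [set y | S (J y)].
Proof.
have lev f : measurable [set y | J y = f].
  rewrite (_ : mkset _ = \bigcap_(k : 'I_n) [set y | J y k = f k]).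
    by apply: fin_bigcap_measurable => // k _; apply: (@vm k); exact: J_adapted.
  by apply/seteqP; split => y /= => [<- //|h]; apply/ffunP => k; exact: h.
rewrite (_ : mkset _ = \bigcup_(f in [set f | S f]) [set y | J y = f]).
  by apply: fin_bigcup_measurable => // f _; exact: lev.
by apply/seteqP; split => y /=; [exists (J y)|move=> [f /= Sf ->]].
Qed.

Let pt_in f : product_set Ak (pt f).
Proof. exact: grid_in. Qed.

Lemma grid_cost_sum (T : Type) (x : T -> PX) (y : T -> borel PX) z :
  Q (x z) (pt (J (y z))) = \sum_f \1_[set y | J y == f] (y z) * Q (x z) (pt f).
Proof.
rewrite (bigD1 (J (y z)))//= big1 => [|f fJ].
  by rewrite addr0 indicE mem_set/= ?eqxx// mul1r.
by rewrite indicE memNset ?mul0r//=; apply/negP; rewrite eq_sym.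
Qed.

Lemma grid_cost_measurable d (T : measurableType d) (x y : T -> borel PX) :
  measurable_fun setT x -> measurable_fun setT y ->
  measurable_fun setT (fun z => Q (x z) (pt (J (y z)))).
Proof.
move=> mx my.
rewrite (_ : (fun z => _) = fun z => \sum_f \1_[set y | J y == f] (y z) * Q (x z) (pt f)).
  apply: measurable_sum => f; apply: measurable_funM.
    apply: (measurableT_comp _ my); apply: measurable_indic.
    exact: (level_measurable (fun g => g == f)).
  exact: (measurableT_comp (Q_meas (pt_in f)) mx).
by apply/funext => z; exact: grid_cost_sum.
Qed.

(* beta_k is the conditional expectation of the k-th coordinate of the grid action
   given (X_k, X_pa(k)). By causality it is also the one given all of X, so that
   Jensen's inequality applies. *)
Lemma feedback : exists2 beta, adapted_action e Ak beta &
  (\int[mu]_x (Q x (beta x))%:E <= \int[P]_z (Q z.1 (pt (J z.2)))%:E)%E.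
Proof.
(* [p (k, c)] is P(J_k(Y) = c | X_k, X_pa(k)), and [r f] below is P(J(Y) = f | X): the former are
   adapted, the latter carry the joint weights. *)
have [p pP] := choice (fun kc : 'I_n * 'I_m.+2 =>
  vertex_conditional polishX sorted_e closed_e causalP (@J_adapted kc.1 kc.2)).
have [r rP] := choice (fun f : I => joint_conditional causalP (level_measurable (pred1 f))).
have mr f : measurable_fun setT (r f) by have [] := rP f.
have r0 f x : 0 <= r f x by have [] := rP f.
have mpv kc : measurable_fun setT (p kc : g_sigma_algebraType (vgen kc.1) -> R).
  by have [] := pP kc.
have mp kc : measurable_fun setT (p kc).
  apply: (sub_measurable_fun _ (mpv kc)); exact: vertex_gen_measurable.
have p0 kc x : 0 <= p kc x by have [] := pP kc.
have sumE (S : pred I) (D : set (borel PX)) : measurable D ->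
    (P ((snd @^-1` [set y | S (J y)] : set Omega) `&` fst @^-1` D) =
     \int[mu]_(x in D) (\sum_(f | S f) r f x)%:E)%E.
  move=> mD.
  have mDf : measurable (fst @^-1` D : set Omega).
    by rewrite -[X in measurable X]setTI; exact: mfst.
  have msn (S' : pred I) : measurable (snd @^-1` [set y | S' (J y)] : set Omega).
    by rewrite -[X in measurable X]setTI; apply: msnd => //; exact: level_measurable.
  under [RHS]eq_integral do rewrite -sumEFin -big_filter.
  rewrite ge0_integral_sum//; last 2 first.
  - by move=> f; apply/measurable_EFinP; exact: measurable_funTS.
  - by move=> f x _; rewrite lee_fin.
  rewrite setIC probI_integral//.
  transitivity (\int[P]_(z in fst @^-1` D) (\sum_(f <- [seq f <- index_enum I | S f])
      (\1_(snd @^-1` [set y | J y == f] : set Omega) z)%:E))%E.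
    apply: eq_integral => z _; rewrite sumEFin; congr EFin.
    rewrite big_filter; have [SJ|SJ] := boolP (S (J z.2)).
      rewrite (bigD1 (J z.2))//= big1 => [|f /andP[_ fJ]].
        by rewrite addr0 !indicE !mem_set//=.
      by rewrite indicE memNset//=; apply/negP; rewrite eq_sym.
    rewrite indicE memNset ?big1//=; last exact/negP.
    by move=> f Sf; rewrite indicE memNset//= => /eqP Jf; move: SJ; rewrite Jf Sf.
  rewrite ge0_integral_sum//; last first.
    move=> f; apply/measurable_EFinP/measurable_indic; exact: (msn (pred1 f)).
  apply: eq_bigr => f _; have [_ _ <-//] := rP f.
  rewrite setIC probI_integral//; exact: (msn (pred1 f)).
have msum (S : pred I) : measurable_fun setT (fun x : borel PX => \sum_(f | S f) r f x).
  rewrite (_ : (fun x => _) = fun x => \sum_(f <- [seq f <- index_enum I | S f]) r f x).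
    exact: measurable_sum.
  by apply/funext => x; rewrite big_filter.
have ae1 : {ae mu, forall x, \sum_f r f x = 1}.
  refine (@density_unique _ _ _ mu P (fun x => \sum_f r f x) (cst 1)
    (snd @^-1` [set y | predT (J y)]) (msum predT) _ _ _ _ _).
  - exact: measurable_cst.
  - by move=> x; exact: sumr_ge0.
  - by rewrite (_ : _ @^-1` _ = setT)//; apply/seteqP; split.
  - by move=> D mD; exact: (sumE predT).
  - move=> D mD; rewrite (integral_cst mu mD 1) mul1e (_ : [set y | _] = setT); last first.
      by apply/seteqP; split.
    by rewrite preimage_setT setTI; case: causalP => -[h _] _; exact: h.
(* The marginals of the joint weights are the adapted densities, by uniqueness of conditional
   probabilities given X. *)
have aek : {ae mu, forall x, forall kc : 'I_n * 'I_m.+2,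
    p kc x = \sum_(f : I | f kc.1 == kc.2) r f x}.
  apply: filter_forall => -[k c].
  have kcE : [set y | J y k = c] = [set y | J y k == c].
    by apply/seteqP; split => y /= /eqP.
  have mk : measurable (snd @^-1` [set y | J y k == c] : set Omega).
    rewrite -[X in measurable X]setTI; apply: msnd => //.
    exact: (level_measurable (fun f : I => f k == c)).
  apply: (density_unique (P := P) (mp _) _ (p0 _) mk).
  - exact: (msum (fun f : I => f k == c)).
  - by move=> D mD; rewrite -kcE; have [_ _ ->] := pP (k, c).
  - by move=> D mD; exact: (sumE (fun f : I => f k == c)).
(* The average lies in the interval only almost surely, but an action must be admissible everywhere;
   clamping preserves adaptedness. *)
pose b k x := Num.max (l k) (Num.min (u k) (\sum_c p (k, c) x * grid_point l u m k c)).
pose beta (x : PX) : 'rV[R]_n := \row_k b k x.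
have Ab x : product_set Ak (beta x).
  by move=> k; rewrite mxE; apply/AkE; rewrite le_max lexx/= ge_max lu ge_min lexx.
exists beta.
  move=> k; split=> [x|B mB]; first exact: Ab.
  have mbk : measurable_fun setT (b k : g_sigma_algebraType (vgen k) -> R).
    apply: measurable_maxr => //; apply: measurable_minr => //.
    apply: measurable_sum => c; apply: measurable_funM => //.
    exact: (mpv (k, c)).
  rewrite (_ : [set x | _] = b k @^-1` B).
    by rewrite -[X in sigma_vertex_pa _ _ X]setTI; exact: mbk.
  by apply/seteqP; split => x /=; rewrite mxE.
have betaE : {ae mu, forall x, ((Q x (beta x))%:E <= (\sum_f r f x * Q x (pt f))%:E)%E}.
  apply: filterS2 ae1 aek => x x1 xk; rewrite lee_fin.
  have [Ax jx] := jensen A_convex (@Q_convex x) (r0^~ x) pt_in x1.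
  suff -> : beta x = \sum_f r f x *: pt f by [].
  apply/rowP => k; rewrite mxE /b.
  have -> : \sum_c p (k, c) x * grid_point l u m k c = (\sum_f r f x *: pt f) ord0 k.
    rewrite summxE (partition_big (fun f : I => f k) predT)//=.
    apply: eq_bigr => c _; rewrite (xk (k, c)) mulr_suml; apply: eq_bigr => f /eqP fk.
    by rewrite !mxE fk.
  have /AkE /andP[h1 h2] := Ax k.
  by rewrite (min_idPr h2) (max_idPr h1).
have rQ0 f x : 0 <= r f x * Q x (pt f) by rewrite mulr_ge0// Q_ge0.
have mrQ f : measurable_fun setT (fun x : borel PX => r f x * Q x (pt f)).
  by apply: measurable_funM => //; exact: Q_meas.
apply: (@le_trans _ _ (\int[mu]_x (\sum_f r f x * Q x (pt f))%:E)%E).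
  apply: ae_le_lower_integral.
  - by move=> x; rewrite lee_fin Q_ge0.
  - by move=> x; rewrite lee_fin sumr_ge0.
  - by apply/measurable_EFinP; exact: measurable_sum.
  - exact: betaE.
under eq_integral do rewrite -sumEFin.
rewrite ge0_integral_sum//; last 2 first.
- by move=> f; apply/measurable_EFinP.
- by move=> f x _; rewrite lee_fin.
under [leRHS]eq_integral do rewrite grid_cost_sum -sumEFin.
rewrite ge0_integral_sum//; last 2 first.
- move=> f; apply/measurable_EFinP; apply: measurable_funM.
    apply: (measurableT_comp _ msnd); apply: measurable_indic.
    exact: (level_measurable (fun g => g == f)).
  exact: (measurableT_comp (Q_meas (pt_in f)) mfst).
- by move=> f z _; rewrite lee_fin mulr_ge0// Q_ge0.
(* Termwise equality: [r f] is the conditional probability of J(Y) = f given X, and the cost at a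
   fixed grid point is a function of X. *)
apply: lee_sum => f _; rewrite le_eqVlt; apply/orP; left; apply/eqP.
rewrite (integral_fst causalP)//; last 2 first.
- exact/measurable_EFinP.
- by move=> x; rewrite lee_fin.
rewrite preimage_setT.
transitivity (\int[P]_z (Q z.1 (pt f) * r f z.1)%:E)%E.
  by apply: eq_integral => z _; rewrite mulrC.
transitivity (\int[P]_z
    (Q z.1 (pt f) * \1_(snd @^-1` [set y | J y == f] : set Omega) z)%:E)%E; last first.
  by apply: eq_integral => z _; rewrite mulrC.
have mf : measurable (snd @^-1` [set y | J y == f] : set Omega).
  rewrite -[X in measurable X]setTI; apply: msnd => //.
  exact: (level_measurable (pred1 f)).
refine (integralM_eq mfst (fun z => r0 f z.1) _ (fun x => Q_ge0 x (pt_in f))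
  (measurableT_comp (mr f) mfst) _ (Q_meas (pt_in f)) _).
- by move=> z; rewrite indicE.
- exact: measurable_indic.
move=> D mD.
have mDf : measurable (fst @^-1` D : set Omega).
  by rewrite -[X in measurable X]setTI; exact: mfst.
rewrite -probI_integral// -(integral_fst causalP (f := EFin \o r f))//; last 2 first.
- exact/measurable_EFinP.
- by move=> x; rewrite lee_fin.
by have [_ _ <-//] := rP f; rewrite setIC.
Qed.

End feedback.

(** * The inequality along one causal coupling, and its symmetrisation *)

Lemma continuous_real_measurable (R : realType) (T : ptopologicalType) (f : T -> R) :
  continuous f -> measurable_fun setT (f : borel T -> R).
Proof.
move=> /continuousP cf; apply: (measurability _ (RGenOpens.measurableE R)).
move=> _ [_ [x [y ->]] <-]; rewrite setTI; apply: sub_sigma_algebra.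
by apply: cf; exact: interval_open.
Qed.

Section one_sided.
Variables (R : realType) (n : nat) (X : 'I_n -> ptopologicalType).
Hypothesis polishX : forall i, polish R (X i).
Variable e : rel 'I_n.
Hypotheses (sorted_e : sorted_graph e) (closed_e : transitively_closed e).

Local Notation PX := (prod_topology X).
Local Notation Omega := (borel (PX * PX)%type).

Variable dX : PX -> PX -> R.
Hypotheses (metric_dX : is_metric dX) (topology_dX : induces_topology dX).

Variable Ak : 'I_n -> set R.
Hypothesis A_nonempty : product_set Ak !=set0.
Hypothesis A_compact : compact (product_set Ak).
Hypothesis A_convex : convex_set (product_set Ak).

Variables (Q : PX -> 'rV[R]_n -> R) (L : R).
Hypothesis Q_ge0 : forall x a, product_set Ak a -> 0 <= Q x a.
Hypothesis Q_convex : forall x, convex_function (product_set Ak) (Q x).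
Hypothesis L_gt0 : 0 < L.
Hypothesis Q_lipschitz : forall x y a, product_set Ak a ->
  `|Q x a - Q y a| <= L * dX x y.

Let Q_meas a : product_set Ak a -> measurable_fun setT (Q^~ a : borel PX -> R).
Proof.
move=> Aa; apply: continuous_real_measurable.
exact: (lipschitz_continuous topology_dX L_gt0 (fun x y => Q_lipschitz x y Aa)).
Qed.

Lemma distance_measurable : measurable_fun setT (fun z : Omega => dX z.1 z.2).
Proof.
apply: (@continuous_real_measurable _ (PX * PX)%type).
exact: metric_continuous metric_dX topology_dX.
Qed.

Lemma distance_ge0 x y : 0 <= dX x y.
Proof. exact: metric_ge0. Qed.

Lemma constant_action a : product_set Ak a -> adapted_action e Ak (fun _ : PX => a).
Proof.
move=> Aa k; split=> [_|B mB]; first exact: Aa.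
have [Ba|Ba] := pselect (B (a ord0 k)).
  rewrite (_ : mkset _ = setT); last by apply/seteqP; split.
  exact: (@measurableT _ (g_sigma_algebraType (vertex_gen e (Z := X) k))).
rewrite (_ : mkset _ = set0); last by apply/seteqP; split.
exact: (@measurable0 _ (g_sigma_algebraType (vertex_gen e (Z := X) k))).
Qed.

Lemma value_ge0 mu : (0 <= value e Ak Q mu)%E.
Proof.
apply/ereal_infP => _ [alpha aalpha <-]; apply: integral_ge0 => x _.
by rewrite lee_fin Q_ge0// => k; have [] := aalpha k.
Qed.

Lemma finite_cost (mu : probability (borel PX) R) a :
  finite_first_moment dX mu -> product_set Ak a ->
  (\int[mu]_x (Q x a)%:E < +oo)%E.
Proof.
move=> [x0 fin0] Aa.
have mdx0 : measurable_fun setT (fun x : borel PX => dX x x0).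
  apply: (@continuous_real_measurable _ PX (dX^~ x0)).
  apply: (lipschitz_continuous topology_dX ltr01) => x y; rewrite mul1r.
  have [_ dC dT] := metric_dX.
  have := dT x y x0; have := dT y x x0; rewrite (dC y x) ler_norml => h1 h2.
  by apply/andP; split; lra.
have q0 : 0 <= Q x0 a by exact: Q_ge0.
apply: (@le_lt_trans _ _ (\int[mu]_x ((Q x0 a)%:E + L%:E * (dX x x0)%:E))%E).
  apply: le_lower_integral => x; first by rewrite lee_fin Q_ge0.
  rewrite -EFinM -EFinD lee_fin -lerBlDl.
  by apply: le_trans (Q_lipschitz x x0 Aa); exact: ler_norm.
rewrite ge0_integralD//; last 2 first.
- by move=> x _; rewrite -EFinM lee_fin mulr_ge0 ?distance_ge0// ltW.
- have mL : measurable_fun setT (fun x : borel PX => L * dX x x0) by exact: measurable_funM.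
  by have /measurable_EFinP := mL.
rewrite ge0_integralZl//; last 3 first.
- exact/measurable_EFinP.
- by move=> x _; rewrite lee_fin distance_ge0.
- by rewrite lee_fin ltW.
have -> : (\int[mu]__ (Q x0 a)%:E = (Q x0 a)%:E)%E.
  have := integral_cst mu measurableT (Q x0 a)%:E.
  by rewrite [X in (_ * X)%E](@probability_setT _ _ _ mu) mule1.
by apply: lte_add_pinfty; [exact: ltry|rewrite lte_mul_pinfty// lee_fin ltW].
Qed.

Lemma value_fin_num (mu : probability (borel PX) R) :
  finite_first_moment dX mu -> value e Ak Q mu \is a fin_num.
Proof.
move=> mu1; rewrite ge0_fin_numE ?value_ge0//; have [a Aa] := A_nonempty.
apply: le_lt_trans (finite_cost mu1 Aa).
by apply: ereal_inf_lbound; exists (fun=> a) => //; exact: constant_action.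
Qed.

Lemma value_causal_le (mu nu : probability (borel PX) R) (P : probability Omega R) :
  causal_coupling e mu nu P -> finite_first_moment dX nu ->
  (value e Ak Q mu <= value e Ak Q nu + L%:E * \int[P]_z (dX z.1 z.2)%:E)%E.
Proof.
move=> causalP nu1; set W := (\int[P]_z _)%E.
have W0 : (0 <= W)%E by apply: integral_ge0 => z _; rewrite lee_fin distance_ge0.
(* In the infinite case the right-hand side is +oo, because the value of [nu] is not -oo. *)
have [Woo|Wfin] := eqVneq W +oo%E.
  rewrite Woo gt0_muley ?lte_fin// addey ?leey//.
  by rewrite gt_eqF// (lt_le_trans _ (value_ge0 nu)).
have LWfin : (L%:E * W)%E \is a fin_num.
  by rewrite fin_numM// ge0_fin_numE// lt_neqAle Wfin leey.
rewrite -leeBlDr//; apply/ereal_infP => _ [alpha aalpha <-].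
rewrite leeBlDr//.
have [l [u lub]] := box_bounds A_nonempty A_compact A_convex.
have lu k : l k <= u k by have [] := lub k.
have AkE k t : Ak k t <-> l k <= t <= u k by have [] := lub k.
have Aalpha y : product_set Ak (alpha y) by move=> k; have [] := aalpha k.
(* [M] dominates the cost of every action at y, and is integrable because the costs of constant
   actions are. *)
pose M (y : borel PX) := \sum_f Q y (vertex l u f).
have Av f : product_set Ak (vertex l u f) by exact: vertex_in.
have M0 y : 0 <= M y by apply: sumr_ge0 => f _; exact: Q_ge0.
have mM : measurable_fun setT M by apply: measurable_sum => f; exact: Q_meas.
have Mfin : (\int[nu]_y (M y)%:E < +oo)%E.
  under eq_integral do rewrite -sumEFin.
  rewrite ge0_integral_sum//; last 2 first.
  - by move=> f; apply/measurable_EFinP; exact: Q_meas.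
  - by move=> f y _; rewrite lee_fin Q_ge0.
  by apply: lte_sum_pinfty => f _; exact: finite_cost.
apply/lee_addgt0Pr => eps eps0.
pose kappa := fine (\int[nu]_y (M y)%:E)%E.
have IM0 : (0 <= \int[nu]_y (M y)%:E)%E by apply: integral_ge0 => y _; rewrite lee_fin.
have kE : (\int[nu]_y (M y)%:E = kappa%:E)%E by rewrite fineK// ge0_fin_numE.
have k0 : 0 <= kappa by exact: fine_ge0.
(* Rounding costs at most kappa / (m + 1), and m + 1 exceeds kappa / eps. *)
pose m := Num.truncn (kappa / eps).
have mk : m.+1%:R^-1 * kappa <= eps.
  rewrite mulrC ler_pdivrMr// mulrC -ler_pdivrMr//; apply: ltW.
  exact: truncnS_gt.
pose J (y : borel PX) := grid_round l u m (alpha y).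
have J_adapted k c : <<s vertex_gen e (Z := X) k >> [set y | J y k = c].
  have [_ /(_ _ (grid_index_measurable l u k c))] := aalpha k.
  by congr (<<s _ >> _); apply/seteqP; split => y; rewrite /= /J ffunE.
have pt_in f : product_set Ak (grid (m := m) l u f) by exact: grid_in.
have [beta abeta beta_le] := feedback polishX sorted_e closed_e causalP lu AkE
  A_convex Q_ge0 Q_convex Q_meas J_adapted.
have mJ := grid_cost_measurable polishX lu AkE Q_meas J_adapted.
have msnd : measurable_fun setT (snd : Omega -> borel PX) := @borel_snd n X X.
have mid : measurable_fun setT (idfun : borel PX -> borel PX) by exact: measurable_id.
apply: (@le_trans _ _ (\int[mu]_x (Q x (beta x))%:E)%E).
  by apply: ereal_inf_lbound; exists beta.
apply: (le_trans beta_le).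
apply: (@le_trans _ _ (\int[P]_z ((Q z.2 (grid l u (J z.2)))%:E + L%:E * (dX z.1 z.2)%:E))%E).
  apply: le_lower_integral => z; first by rewrite lee_fin Q_ge0.
  rewrite -EFinM -EFinD lee_fin -lerBlDl.
  by apply: le_trans (Q_lipschitz z.1 z.2 (pt_in _)); exact: ler_norm.
have mdist : measurable_fun setT (fun z : Omega => (dX z.1 z.2)%:E).
  by apply/measurable_EFinP; exact: distance_measurable.
rewrite ge0_integralD//; last 4 first.
- by move=> z _; rewrite lee_fin Q_ge0.
- by apply/measurable_EFinP; exact: (mJ _ _ _ _ msnd msnd).
- by move=> z _; rewrite -EFinM lee_fin mulr_ge0 ?distance_ge0// ltW.
- have mL : measurable_fun setT (fun z : Omega => L * dX z.1 z.2).
    by apply: measurable_funM => //; exact: distance_measurable.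
  by have /measurable_EFinP := mL.
rewrite ge0_integralZl//; last 2 first.
- by move=> z _; rewrite lee_fin distance_ge0.
- by rewrite lee_fin ltW.
rewrite -/W [leRHS]addeAC leeD2r//.
apply: (@le_trans _ _ (\int[nu]_y (Q y (grid l u (J y)))%:E)%E).
  rewrite (integral_snd causalP measurableT (f := fun y => (Q y (grid l u (J y)))%:E)).
  - by rewrite preimage_setT.
  - by apply/measurable_EFinP; exact: (mJ _ _ _ _ mid mid).
  - by move=> y; rewrite lee_fin Q_ge0.
have t0 : 0 <= m.+1%:R^-1 :> R by rewrite invr_ge0.
(* The lower integral for [alpha] can be split off because the rounded cost and [M] are
   measurable. *)
apply: (@le_trans _ _ (\int[nu]_y (Q y (alpha y))%:E + \int[nu]_y (m.+1%:R^-1 * M y)%:E)%E).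
  apply: lower_integralD_ge.
  - by move=> y; exact: Q_ge0.
  - by move=> y; rewrite mulr_ge0.
  - by move=> y; exact: Q_ge0.
  - exact: measurable_funM.
  - exact: (mJ _ _ _ _ mid mid).
  - move=> y; apply: (grid_round_le lu AkE m A_convex (@Q_convex y)) => //.
    by move=> a; exact: Q_ge0.
apply: leeD => //; under eq_integral do rewrite EFinM.
rewrite ge0_integralZl//; last 2 first.
- exact/measurable_EFinP.
- by move=> y _; rewrite lee_fin.
by rewrite kE -EFinM lee_fin.
Qed.

End one_sided.

Unset Implicit Arguments.

Theorem theorem3p5 (R : realType) (n : nat) (X : 'I_n -> ptopologicalType)
    (polishX : forall i, polish R (X i))
    (dX : prod_topology X -> prod_topology X -> R)
    (metric_dX : is_metric dX) (topology_dX : induces_topology dX)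
    (e : rel 'I_n) (dag_e : is_dag e) (sorted_e : sorted_graph e)
    (closed_e : transitively_closed e)
    (Ak : 'I_n -> set R)
    (A_nonempty : product_set Ak !=set0) (A_closed : closed (product_set Ak))
    (A_compact : compact (product_set Ak))
    (A_convex : convex_set (product_set Ak))
    (Q : prod_topology X -> 'rV[R]_n -> R)
    (Q_ge0 : forall x a, product_set Ak a -> 0 <= Q x a)
    (Q_convex : forall x, convex_function (product_set Ak) (Q x))
    (L : R) (L_gt0 : 0 < L)
    (Q_lipschitz : forall x y a, product_set Ak a ->
       `|Q x a - Q y a| <= L * dX x y)
    (mu nu : probability (borel (prod_topology X)) R)
    (mu_compatible : compatible_measure1 e dX mu)
    (nu_compatible : compatible_measure1 e dX nu) :
  (`| value e Ak Q mu - value e Ak Q nu |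
     <= L%:E * causal_wasserstein1 e dX mu nu)%E.
Proof.
have [[_ mu1] [_ nu1]] := (mu_compatible, nu_compatible).
have vf m : finite_first_moment dX m -> value e Ak Q m \is a fin_num.
  by move=> ?; exact: (value_fin_num _ metric_dX topology_dX A_nonempty Q_ge0 L_gt0 Q_lipschitz).
have le := value_causal_le polishX sorted_e closed_e metric_dX topology_dX
  A_nonempty A_compact A_convex Q_ge0 Q_convex L_gt0 Q_lipschitz.
(* Dividing by L isolates the infimum, so that each bicausal coupling can be treated on its own. *)
rewrite -lee_pdivrMl//; apply/ereal_infP => _ [P [causalP [_ acausalP]] <-].
rewrite lee_pdivrMl//; set W := (\int[P]_z _)%E.
(* The swapped coupling is causal from [nu] to [mu] and has the same transport cost, by symmetry of
   the metric. *)
have WE : (\int[distribution P (@swap (prod_topology X) (prod_topology X))]_z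
    (dX z.1 z.2)%:E = W)%E.
  rewrite ge0_integral_pushforward//.
  - apply: eq_integral => z _ /=; have [_ dC _] := metric_dX; by rewrite dC.
  - by apply/measurable_EFinP; exact: distance_measurable.
  - by move=> z _; rewrite lee_fin distance_ge0.
have := le _ _ _ causalP nu1; have := le _ _ _ acausalP mu1; rewrite WE -/W.
have W0 : (0 <= L%:E * W)%E.
  apply: mule_ge0; first by rewrite lee_fin ltW.
  by apply: integral_ge0 => z _; rewrite lee_fin distance_ge0.
move: (L%:E * W)%E W0 => C C0.
move: (vf _ mu1) (vf _ nu1); move: (value e Ak Q mu) (value e Ak Q nu).
move: C C0 => [c| |]//= c0 [a| |]// [b| |]// _ _; rewrite ?leey//.
by rewrite -!EFinD !lee_fin => h1 h2; rewrite ler_norml; apply/andP; split; lra.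
Qed.
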